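(* Let $p\in(1,2]$, $1<r\le\frac{p}{p-1}$ and $r'=\frac{r}{r-1}$. There is a constant $C=C(p,r)$ depending only on $p$ and $r$ (in particular not on $m,n,d$) such that the following holds. Let $(\mathcal B,\|\cdot\|)=(\mathbb R^{m\times n},\|\cdot\|_{S_r})$ (Schatten-$r$ norm) with dual norm $\|\cdot\|_*=\|\cdot\|_{S_{r'}}$, or $(\mathcal B,\|\cdot\|)=(\mathbb R^d,\|\cdot\|_{\ell_r})$ with dual norm $\|\cdot\|_*=\|\cdot\|_{\ell_{r'}}$. Let $F:\mathcal B\to\mathbb R$ be differentiable and let $\Delta_1,L,\sigma>0$ be such that $F(x_1)-\inf_{x}F(x)\le\Delta_1$; $\|\nabla F(x)-\nabla F(y)\|_*\le L\|x-y\|$ for all $x,y\in\mathcal B$; and $\mathbb E[\nabla f(x,\xi)]=\nabla F(x)$, $\mathbb E[\|\nabla f(x,\xi)-\nabla F(x)\|_*^p]\le\sigma^p$ for all $x\in\mathcal B$. Then there is $\varepsilon_0>0$ depending only on $\Delta_1,L,\sigma,p,r$ such that for every $\varepsilon\in(0,\varepsilon_0]$ and every integer $$T\ge C\,\frac{\Delta_1L}{\varepsilon^2}\Big(\frac{\sigma}{\varepsilon}\Big)^{\frac{p}{p-1}},$$ the iterates of NSSD-M with constant parameters $$\eta_t\equiv\sqrt{\frac{\Delta_1(1-\beta)}{LT}},\qquad \beta_t\equiv\beta=1-\min\Big\{1,\max\Big\{T^{-\frac{p}{2p-1}},\Big(\frac{\Delta_1L}{\sigma^2K^2T}\Big)^{\frac{p}{3p-2}}\Big\}\Big\},$$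 where $K=K_{p/(p-1)}(\mathcal B)$, satisfy $\mathbb E[\|\nabla F(x_\tau)\|_*]\le\varepsilon$, where $\tau$ is uniformly distributed on $\{1,\dots,T\}$ and independent of the algorithm.
   Context: Gradients are identified with elements of the dual space via the Euclidean (resp. Frobenius) inner product $\langle\cdot,\cdot\rangle$. The Schatten-$r$ norm of a matrix is the $\ell_r$ norm of its singular values. The stochastic gradient oracle is a map $(x,\xi)\mapsto\nabla f(x,\xi)$, where $\xi$ is a random variable. NSSD-M (normalised stochastic steepest descent with momentum): given an initial point $x_1\in\mathcal B$, stepsizes $\eta_t$, momentum parameters $\beta_t\in[0,1)$ and independent copies $\xi_1,\xi_2,\dots$ of $\xi$, set $m_0=\nabla f(x_1,\xi_1)$ and, for $t\ge1$, $$m_t=\beta_tm_{t-1}+(1-\beta_t)\nabla f(x_t,\xi_t),\qquad x_{t+1}=x_t+\eta_td_t,\quad d_t\in\arg\min_{\|d\|\le1}\langle m_t,d\rangle .$$ The $q$-convexity constant of a Banach space $X$ is $K_q(X)=\inf\{K\ge1:\ 2\|x\|^q+\frac{2}{K^q}\|y\|^q\le\|x+y\|^q+\|x-y\|^q\ \ \forall x,y\in X\}$. *)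

(* Defs.v *)
From HB Require Import structures.
From mathcomp Require Import all_boot all_order all_algebra spectral.
From mathcomp Require Import complex.
From mathcomp Require Import all_classical all_reals all_analysis.

Set Implicit Arguments.
Unset Strict Implicit.
Unset Printing Implicit Defensive.

Import Order.TTheory GRing.Theory Num.Theory.
Import numFieldNormedType.Exports.

Local Open Scope classical_set_scope.
Local Open Scope ring_scope.

Section Norms.
Context {R : realType}.

(* For [A : 'M_(m, n)] these are the square roots of the [n] eigenvalues of
   [A^T A], counted with multiplicity.  When [m < n] the list contains [n - m]
   extra zeros, which do not contribute to the Schatten norms below.
   [spectral_diag] works over a closed field, hence the detour through [R[i]];
   the eigenvalues are real since [A^T A] is symmetric. *)
Definition singular_value m n (A : 'M[R]_(m, n)) (j : 'I_n) : R :=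
  Num.sqrt (complex.Re
    (spectral_diag (map_mx (real_complex R) (A^T *m A)) 0 j)).

Definition schatten_norm (r : R) m n (A : 'M[R]_(m, n)) : R :=
  (\sum_(j < n) singular_value A j `^ r) `^ r^-1.

Definition lr_norm (r : R) d (x : 'rV[R]_d) : R :=
  (\sum_(j < d) `|x 0 j| `^ r) `^ r^-1.

(* [normed_space r N Ns]: [N] is the norm and [Ns] the dual norm of one of the
   two kinds of spaces under consideration; R^d is the space of row vectors. *)
Inductive normed_space (r : R) :
    forall m n : nat, ('M[R]_(m, n) -> R) -> ('M[R]_(m, n) -> R) -> Prop :=
| SchattenSpace m n :
    normed_space r (@schatten_norm r m n) (@schatten_norm (r / (r - 1)) m n)
| LrSpace d :
    normed_space r (@lr_norm r d) (@lr_norm (r / (r - 1)) d).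

Definition frobenius m n (A B : 'M[R]_(m, n)) : R := \tr (A^T *m B).

(* The matrix representing the differential for [frobenius]. *)
Definition gradient m n (F : 'M[R]_(m, n) -> R) (x : 'M[R]_(m, n)) :
    'M[R]_(m, n) :=
  \matrix_(i, j) 'd F x (delta_mx i j).

(* The infimum is over a set of reals, so this is meaningful only if some
   finite [K] is admissible, as is the case in [l_r] and [S_r] for
   [q >= max(2, r)]. *)
Definition convexity_constant (q : R) m n (N : 'M[R]_(m, n) -> R) : R :=
  inf [set K | 1 <= K /\ forall x y : 'M[R]_(m, n),
    2 * N x `^ q + 2 / K `^ q * N y `^ q <= N (x + y) `^ q + N (x - y) `^ q].

End Norms.

Notation borel_mx R m n := (g_sigma_algebraType (@open 'M[R]_(m, n))).

Section Probability.
Context d {Omega : measurableType d} {R : realType} (P : probability Omega R).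

Definition mutually_independent d' (S : measurableType d')
    (X : nat -> Omega -> S) : Prop :=
  forall (s : seq nat) (A : nat -> set S), uniq s ->
    (forall i, measurable (A i)) ->
    P (\bigcap_(i in [set` s]) (X i @^-1` A i)) =
      (\prod_(i <- s) P (X i @^-1` A i))%E.

(* [xis] is indexed from 1; [xis 0] is irrelevant. *)
Definition independent_copies d' (S : measurableType d')
    (xi : {RV P >-> S}) (xis : nat -> {RV P >-> S}) : Prop :=
  (forall (t : nat) (A : set S), (0 < t)%N -> measurable A ->
     distribution P (xis t) A = distribution P xi A) /\
  mutually_independent (fun t => xis t.+1 : Omega -> S).

(* The sigma-algebra generated by xi_1, d_1, ..., xi_t, d_t. *)
Definition history d' (S : measurableType d') (xis : nat -> Omega -> S)
    m n (dir : nat -> Omega -> 'M[R]_(m, n)) (t : nat) : set (set Omega) :=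
  <<s [set E | exists2 s : nat, (0 < s <= t)%N &
        (exists2 A : set S, measurable A & E = xis s @^-1` A) \/
        (exists2 B : set (borel_mx R m n), measurable B &
           E = (dir s : Omega -> borel_mx R m n) @^-1` B)] >>.

(* The runs [(x_t), (m_t), (d_t)] of NSSD-M with oracle [g] ([g x s] is the
   stochastic gradient at [x] for the sample [s]).  The minimiser [d_t] need not
   be unique (when [m_t = 0]); ties may be broken arbitrarily, possibly at
   random, but without looking at future samples. *)
Record is_nssd_m d' (S : measurableType d') m n (N : 'M[R]_(m, n) -> R)
    (g : 'M[R]_(m, n) -> S -> 'M[R]_(m, n)) (xis : nat -> Omega -> S)
    (x1 : 'M[R]_(m, n)) (eta beta : nat -> R)
    (x mom dir : nat -> Omega -> 'M[R]_(m, n)) : Prop := {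
  nssd_x1 : forall w, x 1%N w = x1;
  nssd_m0 : forall w, mom 0%N w = g x1 (xis 1%N w);
  nssd_m : forall t w, (0 < t)%N ->
    mom t w = beta t *: mom t.-1 w + (1 - beta t) *: g (x t w) (xis t w);
  nssd_x : forall t w, (0 < t)%N -> x t.+1 w = x t w + eta t *: dir t w;
  nssd_argmin : forall t w, (0 < t)%N -> N (dir t w) <= 1 /\
    forall v, N v <= 1 ->
      frobenius (mom t w) (dir t w) <= frobenius (mom t w) v;
  nssd_measurable : forall t, (0 < t)%N ->
    measurable_fun setT (dir t : Omega -> borel_mx R m n);
  nssd_nonanticipating : forall t (A : set S) (E : set Omega),
    measurable A -> history xis dir t E ->
    P (xis t.+1 @^-1` A `&` E) = (P (xis t.+1 @^-1` A) * P E)%E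
}.

(* [tau] is uniform on {1, ..., T} and independent of the first [T] steps. *)
Definition uniform_independent_index d' (S : measurableType d')
    (xis : nat -> Omega -> S) m n (dir : nat -> Omega -> 'M[R]_(m, n))
    (T : nat) (tau : {RV P >-> nat}) : Prop :=
  (forall w, (0 < tau w <= T)%N) /\
  (forall t, (0 < t <= T)%N -> P (tau @^-1` [set t]) = (T%:R^-1)%:E) /\
  (forall (B : set nat) (E : set Omega), history xis dir T E ->
     P (tau @^-1` B `&` E) = (P (tau @^-1` B) * P E)%E).

End Probability.

Section ParameterChoice.
Context {R : realType}.

Definition momentum_parameter (p Delta1 L sigma K : R) (T : nat) : R :=
  1 - Num.min 1 (Num.max
        (T%:R `^ (- (p / (2 * p - 1))))
        ((Delta1 * L / (sigma ^+ 2 * K ^+ 2 * T%:R)) `^ (p / (3 * p - 2)))).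

Definition stepsize (Delta1 L beta : R) (T : nat) : R :=
  Num.sqrt (Delta1 * (1 - beta) / (L * T%:R)).

End ParameterChoice.

(* Main.v *)
Require Import Defs.
From HB Require Import structures.
From mathcomp Require Import all_boot all_order all_algebra spectral.
From mathcomp Require Import complex.
From mathcomp Require Import all_classical all_reals all_analysis.
From mathcomp Require Import measurable_realfun.
From mathcomp Require Import ring lra.

Set Implicit Arguments.
Unset Strict Implicit.
Unset Printing Implicit Defensive.

Import Order.TTheory GRing.Theory Num.Theory.
Import numFieldNormedType.Exports.

Local Open Scope classical_set_scope.
Local Open Scope ring_scope.

(** Write [q = p / (p - 1)] and [s = r / (r - 1)] for the exponent of the dual
    norm; the assumption on [r] says that [p <= s].

    A step along the minimiser of the momentum decreases [F] by [eta] times the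
    dual norm of the gradient, up to [L eta^2] and twice [eta] times the dual
    norm of the momentum error ([descent_lemma], [one_step_descent]).  That
    error is the sum of a drift, caused by the motion of the iterates and at
    most [L eta / (1 - beta)] ([momentum_drift]), and of an exponentially
    weighted sum of the oracle errors, each of which is centred given the past.
    The crux is to bound the latter sum independently of the dimension.

    For this the dual norm [Ns] need only be [p]-uniformly smooth
    ([uniformly_smooth]) with a constant [K1] depending on [p] and [r].
    Smoothness makes [E (Ns n)^p] grow, when a centred independent increment is
    added to [n], by at most [2 K1] times the [p]-th moment of the increment
    ([moment_centered_perturbation]).  Iterating this through the momentum
    recursion bounds the mean noise at step [k + 1] by
    [sigma (beta^k + (2 K1)^(1/p) (1 - beta)^(1/q))] ([mean_noise]), and
    summing the descent inequality gives [nssd_mean_bound].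

    The constant [K1] is obtained first for sums of [s]-th powers of singular
    values.  For [s <= 2] it comes from Clarkson's inequality
    ([schatten_sum_clarkson]); for [s >= 2] from a second-order expansion whose
    remainder is estimated through Klein's lifting of scalar inequalities to
    pairs of symmetric matrices ([schatten_sum_klein], [schatten_sum_smooth]).
    A linearisation passes from the exponent [s] to [p] ([smooth_of_sums]), and
    vectors are treated as diagonal matrices ([normed_space_smooth]).

    The algorithm is tuned with the convexity constant [K] of the primal norm
    rather than with [K1].  By duality [1 <= K <= K1^(1/p)]
    ([convexity_constant_bounds]), and this range is all that the tuning
    ([parameter_choice]) requires of [K]. *)

(** * Real spectral theorem *)

Section RealSpectral.
Variable R : realType.
Implicit Types n : nat.

Definition orthogonalmx n (U : 'M[R]_n) := U *m U^T = 1%:M.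

Lemma orthogonalmxT n (U : 'M[R]_n) : orthogonalmx U -> U^T *m U = 1%:M.
Proof. by move=> /mulmx1C. Qed.

Lemma orthogonalmx_tr n (U : 'M[R]_n) : orthogonalmx U -> orthogonalmx U^T.
Proof. by rewrite /orthogonalmx trmxK => /orthogonalmxT. Qed.

Lemma orthogonalmxM n (U V : 'M[R]_n) :
  orthogonalmx U -> orthogonalmx V -> orthogonalmx (U *m V).
Proof.
rewrite /orthogonalmx => oU oV.
by rewrite trmx_mul mulmxA -[U *m V *m _]mulmxA oV mulmx1.
Qed.

Lemma orthogonalmx_block m n (U : 'M[R]_m) (V : 'M[R]_n) :
  orthogonalmx U -> orthogonalmx V -> orthogonalmx (block_mx U 0 0 V).
Proof.
rewrite /orthogonalmx => oU oV; rewrite tr_block_mx !trmx0 mulmx_block.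
by rewrite !mulmx0 !mul0mx !addr0 add0r oU oV -scalar_mx_block.
Qed.

Definition row_sqn n (v : 'rV[R]_n) : R := \sum_j v 0 j ^+ 2.

Lemma row_sqnE n (v : 'rV[R]_n) : v *m v^T = (row_sqn v)%:M.
Proof.
apply/matrixP => i j; rewrite !ord1 !mxE eqxx mulr1n.
by apply: eq_bigr => k _; rewrite mxE expr2.
Qed.

Lemma row_sqn_ge0 n (v : 'rV[R]_n) : 0 <= row_sqn v.
Proof. by apply: sumr_ge0 => j _; exact: sqr_ge0. Qed.

Lemma row_sqn_eq0 n (v : 'rV[R]_n) : row_sqn v = 0 -> v = 0.
Proof.
move=> v0; apply/rowP => j; rewrite mxE; apply/eqP; rewrite -sqrf_eq0.
move/eqP: v0; rewrite psumr_eq0 => [|k _]; last exact: sqr_ge0.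
by move=> /allP /(_ j (mem_index_enum _)).
Qed.

(** The Householder reflection exchanging [v] and the first basis vector. *)
Lemma orthogonalmx_first_row n (v : 'rV[R]_(1 + n)) : row_sqn v = 1 ->
  exists2 H : 'M[R]_(1 + n), orthogonalmx H & delta_mx 0 0 *m H = v.
Proof.
move=> v1; set e : 'rV[R]_(1 + n) := delta_mx 0 0.
have [->|w0] := eqVneq v e.
  by exists 1%:M; rewrite /orthogonalmx ?trmx1 mulmx1.
set w := e - v; pose c := (1 - v 0 0)^-1.
have sw0 : row_sqn w != 0.
  by apply: contra_neq w0 => /row_sqn_eq0/subr0_eq.
have e1 : e *m e^T = 1%:M.
  by rewrite /e trmx_delta mul_delta_mx; apply/matrixP => i j; rewrite !ord1 !mxE.
have ev : e *m v^T = (v 0 0)%:M.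
  apply/matrixP => i j; rewrite !ord1 /e -rowE !mxE eqxx mulr1n //.
have ve : v *m e^T = (v 0 0)%:M by rewrite -[LHS]trmxK trmx_mul trmxK ev tr_scalar_mx.
have ew : e *m w^T = (1 - v 0 0)%:M by rewrite /w linearB /= mulmxBr e1 ev raddfB.
have sw : row_sqn w = 2 * (1 - v 0 0).
  have : w *m w^T = (2 * (1 - v 0 0))%:M.
    rewrite {1}/w mulmxBl ew /w linearB /= mulmxBr ve row_sqnE v1 -!raddfB /=.
    by congr (_%:M); ring.
  by rewrite row_sqnE => /matrixP /(_ 0 0); rewrite !mxE eqxx !mulr1n.
have ewv : e - w = v by rewrite /w subKr.
have cE : c * (1 - v 0 0) = 1.
  by rewrite /c mulVf //; apply: contra_neq sw0; rewrite sw => ->; rewrite mulr0.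
clearbody w c => {w0 ev ve}.
pose H : 'M[R]_(1 + n) := 1%:M - c *: (w^T *m w).
have HT : H^T = H by rewrite /H linearB linearZ /= trmx1 trmx_mul trmxK.
exists H; last by rewrite /H mulmxBr mulmx1 -scalemxAr mulmxA ew mul_scalar_mx
    scalerA cE scale1r.
  rewrite /orthogonalmx HT /H mulmxBl mul1mx mulmxBr mulmx1 -scalemxAl -scalemxAr.
  rewrite mulmxA -[_ *m w *m _]mulmxA row_sqnE mul_mx_scalar -scalemxAl !scalerA.
  have -> : c * (c * row_sqn w) = c + c by rewrite sw (mulrCA c 2) cE; ring.
  by rewrite scalerDl opprB addrK subrK.
Qed.

(** The bridge from real symmetric matrices to the spectral theory of normal
    matrices over an algebraically closed field. *)
Lemma map_real_hermsym n (X : 'M[R]_n) :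
  X^T = X -> map_mx (real_complex R) X \is hermsymmx.
Proof.
move=> Xsym; apply/is_hermitianmxP; rewrite expr0 scale1r; apply/matrixP => i j.
by rewrite !mxE -[in LHS]Xsym mxE [RHS]conjc_real.
Qed.

(** Deflation: a real eigenvalue exists because the complex spectrum of a
    Hermitian matrix is real; a reflection moves a unit eigenvector to the
    first basis vector, and symmetry clears the first row and column. *)
Lemma real_spectral n (X : 'M[R]_n) : X^T = X ->
  exists U : 'M[R]_n, exists2 d : 'rV[R]_n,
    orthogonalmx U & X = U^T *m diag_mx d *m U.
Proof.
elim: n X => [|n IH] X Xsym.
  by exists 1%:M, 0; rewrite /orthogonalmx; apply/matrixP => -[].
have [v v1 [a Xv]] : exists2 v : 'rV[R]_(1 + n), row_sqn v = 1 & exists a, v *m X = a *: v.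
  have : exists a, eigenvalue X a.
    pose XC := map_mx (real_complex R) X.
    have hX : XC \is hermsymmx := map_real_hermsym Xsym.
    have /hermitian_normalmx/orthomx_spectralP XE := hX.
    have /mxOverP/(_ 0 0) := hermitian_spectral_diag_real hX.
    set P := spectralmx XC in XE; set sp := spectral_diag XC in XE *.
    move=> /complex_realP[a spa]; exists a.
    rewrite -(eigenvalue_map (real_complex R)); apply/eigenvalueP.
    exists (row 0 P).
      rewrite -/XC XE !mulmxA -row_mul mulmxV ?spectral_unit // row1.
      by rewrite -rowE row_diag_mx -scalemxAl -rowE spa.
    rewrite rowE; apply: contraTneq isT => /(congr1 (mulmx^~ (invmx P))).
    rewrite mul0mx mulmxK ?spectral_unit // => /rowP /(_ 0).
    by rewrite !mxE eqxx /= => /eqP; rewrite oner_eq0.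
  move=> [a /eigenvalueP[u uX u0]].
  have su : 0 < row_sqn u.
    by rewrite lt0r row_sqn_ge0 andbT; apply: contra_neq u0 => /row_sqn_eq0.
  exists ((Num.sqrt (row_sqn u))^-1 *: u); last first.
    by exists a; rewrite -scalemxAl uX !scalerA mulrC.
  rewrite /row_sqn; under eq_bigr do rewrite mxE exprMn.
  by rewrite -mulr_sumr exprVn sqr_sqrtr ?ltW // mulVf // gt_eqF.
have [H oH eH] := orthogonalmx_first_row v1.
pose Y := H *m X *m H^T.
have HTH : H^T *m H = 1%:M := orthogonalmxT oH.
have XY : X = H^T *m Y *m H.
  by rewrite /Y !mulmxA HTH mul1mx -mulmxA HTH mulmx1.
have Ysym : Y^T = Y by rewrite /Y !trmx_mul trmxK Xsym mulmxA.
have eY : delta_mx (0 : 'I_1) 0 *m Y = a *: delta_mx 0 0.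
  by rewrite /Y !mulmxA eH Xv -eH -scalemxAl -mulmxA oH mulmx1.
have Y0 j : Y 0 j = a * (j == 0)%:R.
  by move/rowP: eY => /(_ j); rewrite -rowE !mxE eqxx.
clearbody Y.
have YE : Y = block_mx a%:M 0 0 (drsubmx (Y : 'M[R]_(1 + n))).
  rewrite -{1}[Y](@submxK _ 1 n 1 n); congr block_mx; apply/matrixP => i j.
  - by rewrite !mxE !ord1 (lshift0 n 0) Y0 eqxx mulr1.
  - by rewrite !mxE !ord1 (lshift0 n 0) Y0 mulr0.
  - by rewrite !mxE !ord1 (lshift0 n 0) -Ysym mxE Y0 mulr0.
have [|U [d oU dE]] := IH (drsubmx (Y : 'M[R]_(1 + n))).
  by rewrite trmx_drsub Ysym.
pose V : 'M[R]_(1 + n) := block_mx 1%:M 0 0 U.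
have oV : orthogonalmx V.
  by apply: orthogonalmx_block => //; rewrite /orthogonalmx trmx1 mulmx1.
exists (V *m H), (row_mx a%:M d : 'rV[R]_(1 + n)); first exact: orthogonalmxM.
rewrite {1}XY trmx_mul mulmxA; congr (_ *m _); rewrite -!mulmxA; congr (_ *m _).
suff: (Y : 'M[R]_(1 + n)) = V^T *m (diag_mx (row_mx a%:M d) *m V) by [].
rewrite YE dE /V tr_block_mx !trmx0 trmx1 diag_mx_row.
rewrite !mulmx_block !mul0mx !mulmx0 !addr0 !add0r mulmx1 mulmxA.
rewrite ?mul1mx !mulmx0.
by congr block_mx; apply/matrixP => i j; rewrite !ord1 !mxE.
Qed.

End RealSpectral.

(** * Sums of powers of singular values *)

Section SchattenSums.
Variable R : realType.

Lemma orthogonalmx_row n (W : 'M[R]_n) i :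
  orthogonalmx W -> \sum_j W i j ^+ 2 = 1.
Proof.
move=> /matrixP /(_ i i); rewrite !mxE eqxx mulr1n => <-.
by apply: eq_bigr => j _; rewrite mxE expr2.
Qed.

Lemma orthogonalmx_col n (W : 'M[R]_n) j :
  orthogonalmx W -> \sum_i W i j ^+ 2 = 1.
Proof.
move=> /orthogonalmx_tr /(orthogonalmx_row j) <-.
by apply: eq_bigr => i _; rewrite mxE.
Qed.

Lemma orthogonalmx_mulT n (U V : 'M[R]_n) :
  orthogonalmx U -> orthogonalmx V -> orthogonalmx (U *m V^T).
Proof. by move=> oU oV; apply: orthogonalmxM => //; apply: orthogonalmx_tr. Qed.

Definition col_sqn m n (A : 'M[R]_(m, n)) (j : 'I_n) : R := \sum_i A i j ^+ 2.

Lemma col_sqn_ge0 m n (A : 'M[R]_(m, n)) j : 0 <= col_sqn A j.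
Proof. by apply: sumr_ge0 => i _; exact: sqr_ge0. Qed.

Lemma col_sqnE m n (A : 'M[R]_(m, n)) j : (A^T *m A) j j = col_sqn A j.
Proof. by rewrite mxE; apply: eq_bigr => i _; rewrite mxE expr2. Qed.

(** The right half of a singular value decomposition, [d] holding the squared
    singular values. *)
Definition right_svd m n (A : 'M[R]_(m, n)) (U : 'M[R]_n) (d : 'rV[R]_n) :=
  orthogonalmx U /\ A^T *m A = U^T *m diag_mx d *m U.

Lemma right_svd_diag m n (A : 'M[R]_(m, n)) U d : right_svd A U d ->
  (A *m U^T)^T *m (A *m U^T) = diag_mx d.
Proof.
move=> [oU AE]; rewrite trmx_mul trmxK -mulmxA (mulmxA A^T) AE.
by rewrite !mulmxA oU mul1mx -mulmxA oU mulmx1.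
Qed.

Lemma right_svd_col m n (A : 'M[R]_(m, n)) U d j : right_svd A U d ->
  d 0 j = col_sqn (A *m U^T) j.
Proof. by move=> /right_svd_diag AE; rewrite -col_sqnE AE mxE eqxx. Qed.

Lemma right_svd_ge0 m n (A : 'M[R]_(m, n)) U d j : right_svd A U d ->
  0 <= d 0 j.
Proof. by move=> /right_svd_col ->; exact: col_sqn_ge0. Qed.

Lemma right_svd_exists m n (A : 'M[R]_(m, n)) : exists U d, right_svd A U d.
Proof.
have [|U [d oU dE]] := @real_spectral R n (A^T *m A).
  by rewrite trmx_mul trmxK.
by exists U, d.
Qed.

(** The squared overlaps of two orthonormal eigenbases of one matrix form a
    doubly stochastic matrix supported on the pairs of equal eigenvalues;
    averaging with it turns one sum into the other. *)
Lemma spectral_sum_unique n (P : 'M[R[i]]_n) (sp : 'rV[R[i]]_n)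
    (U : 'M[R]_n) (d : 'rV[R]_n) (f : R -> R) :
  P \is unitarymx -> orthogonalmx U ->
  map_mx (real_complex R) (U^T *m diag_mx d *m U) =
    invmx P *m diag_mx sp *m P ->
  \sum_j f (complex.Re (sp 0 j)) = \sum_j f (d 0 j).
Proof.
move=> oP oU; rewrite !map_mxM map_diag_mx -map_trmx.
have UCK : map_mx (real_complex R) U *m (map_mx (real_complex R) U)^T = 1%:M.
  by rewrite map_trmx -map_mxM oU map_mx1.
have : (map_mx (real_complex R) U)^T \is unitarymx.
  apply/unitarymxP; rewrite trmxK.
  have -> : map_mx Num.conj (map_mx (real_complex R) U) = map_mx (real_complex R) U.
    by apply/matrixP => i j; rewrite !mxE; exact: conjc_real.
  exact: mulmx1C.
move: (map_mx (real_complex R) U) UCK => UC UCK oUC XE.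
have [W oW WE] : exists2 W : 'M[R[i]]_n, W \is unitarymx &
    forall i j, sp 0 i * W i j = W i j * real_complex R (d 0 j).
  exists (P *m UC^T); first exact: (mul_unitarymx oP oUC).
  have E : diag_mx sp *m (P *m UC^T) =
      P *m UC^T *m diag_mx (map_mx (real_complex R) d).
    rewrite -mulmxA; have := congr1 (fun X => P *m (X *m UC^T)) XE.
    rewrite -!mulmxA UCK mulmx1 => ->.
    by rewrite !mulmxA (mulmxV (unitarymx_unit oP)) mul1mx.
  move=> i j; move/matrixP: E => /(_ i j).
  by rewrite mul_diag_mx mul_mx_diag mxE [RHS]mxE [map_mx _ _ _ _]mxE.
pose w i j := complex.Re (W i j * Num.conj (W i j)).
have w_row i : \sum_j w i j = 1.
  have /unitarymxP/matrixP/(_ i i) := oW; rewrite !mxE eqxx mulr1n => E.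
  transitivity (complex.Re (1 : R[i])) => //; rewrite -E raddf_sum /=.
  by apply: eq_bigr => j _; rewrite !mxE.
have w_col j : \sum_i w i j = 1.
  have /unitarymxP/mulmx1C/matrixP/(_ j j) := oW; rewrite !mxE eqxx mulr1n => E.
  transitivity (complex.Re (1 : R[i])) => //; rewrite -E raddf_sum /=.
  by apply: eq_bigr => i _; rewrite !mxE mulrC.
transitivity (\sum_i \sum_j w i j * f (complex.Re (sp 0 i))).
  by apply: eq_bigr => i _; rewrite -mulr_suml w_row mul1r.
rewrite exchange_big /=; apply: eq_bigr => j _.
rewrite -[RHS]mul1r -(w_col j) mulr_suml; apply: eq_bigr => i _.
have [W0|W0] := eqVneq (W i j) 0; first by rewrite /w W0 mul0r !mul0r.
suff -> : sp 0 i = real_complex R (d 0 j) by [].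
by apply: (mulIf W0); rewrite WE mulrC.
Qed.

(** Any real diagonalisation of [A^T A] computes symmetric functions of the
    singular values, which are defined through a complex one. *)
Lemma singular_valueE m n (A : 'M[R]_(m, n)) U d (f : R -> R) :
  right_svd A U d ->
  \sum_j f (singular_value A j) = \sum_j f (Num.sqrt (d 0 j)).
Proof.
move=> [oU AE]; rewrite /singular_value.
apply: (spectral_sum_unique (f \o Num.sqrt) (spectral_unitarymx _) oU).
rewrite -AE; apply/orthomx_spectralP; apply: hermitian_normalmx.
by apply: map_real_hermsym; rewrite trmx_mul trmxK.
Qed.

Definition schatten_sum (s : R) m n (A : 'M[R]_(m, n)) : R :=
  \sum_(j < n) singular_value A j `^ s.

Lemma schatten_sum_ge0 s m n (A : 'M[R]_(m, n)) : 0 <= schatten_sum s A.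
Proof. by apply: sumr_ge0 => j _; exact: powR_ge0. Qed.

Lemma schatten_sumE s m n (A : 'M[R]_(m, n)) U d : right_svd A U d ->
  schatten_sum s A = \sum_j d 0 j `^ (s / 2).
Proof.
move=> Ad; rewrite /schatten_sum (singular_valueE (fun x => x `^ s) Ad).
apply: eq_bigr => j _.
by rewrite -powR12_sqrt ?(right_svd_ge0 _ Ad)// -powRrM mulrC.
Qed.

Lemma right_svd_scale m n (A : 'M[R]_(m, n)) U d c : right_svd A U d ->
  right_svd (c *: A) U (c ^+ 2 *: d).
Proof.
move=> [oU AE]; split => //; have -> : (c *: A)^T = c *: A^T by rewrite linearZ.
rewrite -scalemxAl -scalemxAr AE scalerA -expr2.
have -> : diag_mx (c ^+ 2 *: d) = c ^+ 2 *: diag_mx d by rewrite linearZ.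
by rewrite -scalemxAr -scalemxAl.
Qed.

Lemma schatten_sumZ s m n (A : 'M[R]_(m, n)) c :
  schatten_sum s (c *: A) = `|c| `^ s * schatten_sum s A.
Proof.
have [U [d Ad]] := right_svd_exists A.
rewrite (schatten_sumE _ Ad) (schatten_sumE _ (right_svd_scale c Ad)) mulr_sumr.
apply: eq_bigr => j _; rewrite mxE powRM ?sqr_ge0 ?(right_svd_ge0 _ Ad)//.
rewrite -real_normK ?num_real// -powR_mulrn// -powRrM.
by congr (_ `^ _ * _); rewrite mulrC divfK.
Qed.

Lemma schatten_sumN s m n (A : 'M[R]_(m, n)) :
  schatten_sum s (- A) = schatten_sum s A.
Proof. by rewrite -scaleN1r schatten_sumZ normrN1 powR1 mul1r. Qed.

Lemma schatten_sum_eq0 s m n (A : 'M[R]_(m, n)) : schatten_sum s A = 0 -> A = 0.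
Proof.
have [U [d Ad]] := right_svd_exists A.
rewrite (schatten_sumE _ Ad) => /eqP.
rewrite psumr_eq0 => [/allP d0|j _]; last exact: powR_ge0.
suff: A *m U^T = 0.
  move=> /(congr1 (mulmx^~ U)); rewrite mul0mx -mulmxA.
  by case: Ad => /orthogonalmxT -> _; rewrite mulmx1.
apply/matrixP => i j; rewrite [RHS]mxE.
have := d0 j (mem_index_enum _); rewrite /= => /eqP/powR_eq0_eq0.
rewrite (right_svd_col j Ad) => /eqP; rewrite psumr_eq0 => [|k _]; last exact: sqr_ge0.
by move=> /allP/(_ i (mem_index_enum _)); rewrite sqrf_eq0 => /eqP.
Qed.

End SchattenSums.

(** * Inequalities for sums of powers of singular values *)

Section PowerInequalities.
Variable R : realType.
Implicit Types x y c s t : R.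

Lemma gt0_powRD x s t : 0 < x -> x `^ (s + t) = x `^ s * x `^ t.
Proof. by move=> x0; rewrite powRD// (gt_eqF x0) implybT. Qed.

(** Tangent lines to a convex power, from Young's inequality. *)
Lemma powR_ge_tangent s x c : 1 <= s -> 0 <= x -> 0 < c ->
  c `^ s + s * c `^ (s - 1) * (x - c) <= x `^ s.
Proof.
rewrite le_eqVlt => /predU1P[<- x0 c0|s1 x0 c0].
  rewrite subrr powRr0 (powRr1 x0) (powRr1 (ltW c0)); lra.
have s0 : 0 < s by lra.
have := @conjugate_powR R x (c `^ (s - 1)) s (s / (s - 1)) x0 (powR_ge0 _ _) s0.
rewrite divr_gt0 ?subr_gt0// => /(_ isT) Y.
have := Y; rewrite -powRrM mulrCA divff ?subr_eq0 ?gt_eqF// mulr1 => {}Y.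
have {}Y := Y (ltac:(by field; rewrite subr_eq0 !gt_eqF)).
have -> : s * c `^ (s - 1) * (x - c) = s * (x * c `^ (s - 1)) - s * c `^ s.
  by rewrite -(mulr_powRB1 (ltW c0) s0); ring.
have E : s * (x `^ s / s + c `^ s / (s / (s - 1))) = x `^ s + (s - 1) * c `^ s.
  by field; rewrite subr_eq0 !gt_eqF.
have := ler_wpM2l (ltW s0) Y; rewrite E; lra.
Qed.

(** The concave counterpart, from Young's inequality for the exponents [t^-1]
    and [(1 - t)^-1]. *)
Lemma powR_le_tangent t x c : 0 < t -> t <= 1 -> 0 <= x -> 0 < c ->
  x `^ t <= c `^ t + t * c `^ (t - 1) * (x - c).
Proof.
move=> t0; rewrite le_eqVlt => /predU1P[->|t1] x0 c0.
  rewrite subrr powRr0 (powRr1 x0) (powRr1 (ltW c0)); lra.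
have t1' : 0 < 1 - t by rewrite subr_gt0.
have := @conjugate_powR R (x `^ t) (c `^ (1 - t)) t^-1 (1 - t)^-1
  (powR_ge0 _ _) (powR_ge0 _ _).
rewrite !invr_gt0 !invrK addrCA subrr addr0 => /(_ t0 t1' erefl).
rewrite -!powRrM !divff ?(gt_eqF t0) ?(gt_eqF t1')// (powRr1 x0) (powRr1 (ltW c0)) => Y.
have ct : c `^ (t - 1) * c `^ (1 - t) = 1.
  by rewrite -gt0_powRD// (_ : t - 1 + (1 - t) = 0) ?powRr0//; ring.
have := ler_wpM2l (powR_ge0 c (t - 1)) Y.
rewrite mulrCA ct mulr1 => /le_trans; apply.
rewrite -(mulr_powRB1 (ltW c0) t0); lra.
Qed.

End PowerInequalities.

Section SchattenInequalities.
Variable R : realType.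

(** In singular bases [A] becomes a matrix [M] with [M^T M] and [M M^T]
    diagonal; the entry [M i j] vanishes unless the two diagonal entries agree,
    so both sums weigh [(M i j)^2] by the power [s / 2 - 1] of their common
    value. *)
Lemma schatten_sum_tr (s : R) m n (A : 'M[R]_(m, n)) : 0 < s ->
  schatten_sum s A^T = schatten_sum s A.
Proof.
move=> s0; have [U [d Ad]] := right_svd_exists A.
have [V [e Ae]] := right_svd_exists A^T.
rewrite (schatten_sumE _ Ad) (schatten_sumE _ Ae).
pose M := V *m A *m U^T.
have [oU AE] := Ad; have [oV ATE] := Ae; rewrite trmxK in ATE.
have MTM : M^T *m M = diag_mx d.
  rewrite -(right_svd_diag Ad) /M -mulmxA trmx_mul -!mulmxA (mulmxA V^T).
  by rewrite orthogonalmxT// mul1mx.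
have MMT : M *m M^T = diag_mx e.
  rewrite /M trmx_mul trmxK -mulmxA (mulmxA U^T) orthogonalmxT// mul1mx.
  rewrite trmx_mul -mulmxA (mulmxA A) ATE !mulmxA oV mul1mx -mulmxA oV.
  by rewrite mulmx1.
clearbody M.
have MC i j : e 0 i * M i j = M i j * d 0 j.
  have /matrixP/(_ i j) := mulmxA M M^T M.
  by rewrite MTM MMT mul_diag_mx mul_mx_diag !mxE => ->.
have hE (x : R) : 0 <= x -> x `^ (s / 2) = x * x `^ (s / 2 - 1).
  by move=> x0; rewrite mulr_powRB1// divr_gt0.
have dE j : d 0 j = \sum_i M i j ^+ 2.
  by rewrite -[RHS]col_sqnE MTM mxE eqxx.
have eE i : e 0 i = \sum_j M i j ^+ 2.
  have /matrixP/(_ i i) := MMT; rewrite [in RHS]mxE eqxx mulr1n => <-.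
  by rewrite mxE; apply: eq_bigr => j _; rewrite mxE expr2.
transitivity (\sum_i \sum_j M i j ^+ 2 * e 0 i `^ (s / 2 - 1)).
  by apply: eq_bigr => i _; rewrite hE ?(right_svd_ge0 _ Ae)// -mulr_suml -eE.
rewrite exchange_big; apply: eq_bigr => j _ /=.
rewrite hE ?(right_svd_ge0 _ Ad)// [X in _ = X * _]dE mulr_suml; apply: eq_bigr => i _.
have [->|M0] := eqVneq (M i j) 0; first by rewrite expr0n !mul0r.
by congr (_ * _ `^ _); apply: (mulIf M0); rewrite MC mulrC.
Qed.

Lemma col_sqn_spectral m n (H : 'M[R]_(m, n)) (U Z : 'M[R]_n) d i : right_svd H Z d ->
  col_sqn (H *m U^T) i = \sum_j (U *m Z^T) i j ^+ 2 * d 0 j.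
Proof.
move=> [oZ HE]; set W := U *m Z^T.
rewrite -col_sqnE trmx_mul trmxK -mulmxA (mulmxA H^T) HE.
have -> : U *m (Z^T *m diag_mx d *m Z *m U^T) = W *m diag_mx d *m W^T.
  by rewrite /W trmx_mul trmxK !mulmxA.
rewrite mxE; apply: eq_bigr => j _.
by rewrite mul_mx_diag !mxE expr2 mulrAC.
Qed.

(** Peierls' inequality for a concave power: Jensen in each direction of an
    arbitrary orthonormal basis, summed over the basis. *)
Lemma schatten_sum_le_basis (s : R) m n (A : 'M[R]_(m, n)) (V : 'M[R]_n) :
  0 < s -> s <= 2 -> orthogonalmx V ->
  schatten_sum s A <= \sum_i col_sqn (A *m V^T) i `^ (s / 2).
Proof.
move=> s0 s2 oV; have [U [d Ad]] := right_svd_exists A.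
have [oU AE] := Ad.
rewrite (schatten_sumE _ Ad).
pose W := V *m U^T; have oW : orthogonalmx W := orthogonalmx_mulT oV oU.
have colE i : col_sqn (A *m V^T) i = \sum_j W i j ^+ 2 * d 0 j.
  exact: col_sqn_spectral.
have t0 : 0 < s / 2 by rewrite divr_gt0.
have t1 : s / 2 <= 1 by lra.
suff H i : \sum_j W i j ^+ 2 * d 0 j `^ (s / 2) <= col_sqn (A *m V^T) i `^ (s / 2).
  apply: le_trans (ler_sum _ (fun i _ => H i)).
  rewrite exchange_big /=; apply: ler_sum => j _.
  by rewrite -mulr_suml (orthogonalmx_col _ oW) mul1r.
have [c0|c0] := eqVneq (col_sqn (A *m V^T) i) 0.
  rewrite big1 ?powR_ge0// => j _.
  have : \sum_j W i j ^+ 2 * d 0 j == 0 by rewrite -colE c0.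
  rewrite psumr_eq0 => [|k _]; last by rewrite mulr_ge0 ?sqr_ge0 ?(right_svd_ge0 _ Ad).
  move=> /allP/(_ j (mem_index_enum _)) /=.
  rewrite mulf_eq0 => /orP[/eqP->|/eqP->]; first by rewrite mul0r.
  by rewrite powR0 ?mulr0 ?gt_eqF.
have {}c0 : 0 < col_sqn (A *m V^T) i by rewrite lt0r c0 col_sqn_ge0.
set c := col_sqn _ _ in c0 colE *.
have := @ler_sum _ _ _ xpredT (fun j => W i j ^+ 2 * d 0 j `^ (s / 2)) _ (fun j _ => ler_wpM2l (sqr_ge0 (W i j))
  (powR_le_tangent t0 t1 (right_svd_ge0 j Ad) c0)).
move=> /(_ (index_enum _)) /le_trans; apply.
under eq_bigr do rewrite mulrDr mulrCA mulrBr.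
rewrite big_split /= -mulr_suml (orthogonalmx_row _ oW) mul1r.
rewrite -mulr_sumr sumrB -colE -/c -mulr_suml (orthogonalmx_row _ oW) mul1r.
by rewrite subrr mulr0 addr0.
Qed.

(** Pinching: the right singular bases of [A] and [B] together form an
    orthonormal basis, to which Peierls' inequality applies. *)
Lemma schatten_sum_row_mx (s : R) m n1 n2 (A : 'M[R]_(m, n1)) (B : 'M[R]_(m, n2)) :
  0 < s -> s <= 2 ->
  schatten_sum s (row_mx A B) <= schatten_sum s A + schatten_sum s B.
Proof.
move=> s0 s2; have [U [d Ad]] := right_svd_exists A.
have [V [e Be]] := right_svd_exists B.
have oUV := orthogonalmx_block (proj1 Ad) (proj1 Be).
apply: le_trans (schatten_sum_le_basis _ s0 s2 oUV) _.
rewrite tr_block_mx !trmx0 mul_row_block !mulmx0 addr0 add0r.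
rewrite big_split_ord /= (schatten_sumE _ Ad) (schatten_sumE _ Be).
rewrite lerD// le_eqVlt; apply/orP; left; apply/eqP; apply: eq_bigr => j _.
  rewrite (right_svd_col j Ad); congr (_ `^ _); apply: eq_bigr => i _.
  by rewrite row_mxEl.
rewrite (right_svd_col j Be); congr (_ `^ _); apply: eq_bigr => i _.
by rewrite row_mxEr.
Qed.

Lemma col_sqn_par m n (A B : 'M[R]_(m, n)) j :
  col_sqn (A + B) j + col_sqn (A - B) j = 2 * (col_sqn A j + col_sqn B j).
Proof.
rewrite /col_sqn -!big_split mulr_sumr; apply: eq_bigr => i _ /=.
rewrite !mxE; ring.
Qed.

Lemma powR_half_sum_le (t x y : R) : 0 < t -> t <= 1 -> 0 <= x -> 0 <= y ->
  x `^ t + y `^ t <= 2 * ((x + y) / 2) `^ t.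
Proof.
move=> t0 t1 x0 y0; have [z0|z0] := eqVneq (x + y) 0.
  have -> : x = 0 by lra.
  have -> : y = 0 by lra.
  by rewrite addr0 mul0r !powR0 ?gt_eqF//; lra.
have z1 : 0 < (x + y) / 2 by rewrite divr_gt0// lt0r z0 addr_ge0.
have := powR_le_tangent t0 t1 x0 z1; have := powR_le_tangent t0 t1 y0 z1.
set a := t * _; have : a * (x - (x + y) / 2) + a * (y - (x + y) / 2) = 0 by field.
lra.
Qed.

(** Clarkson's inequality for exponents at most [2]: compare [A + B] and
    [A - B] to the stacked matrix [col_mx A B] in a right singular basis of
    the latter, then pinch. *)
Lemma schatten_sum_clarkson (s : R) m n (A B : 'M[R]_(m, n)) : 0 < s -> s <= 2 ->
  schatten_sum s (A + B) + schatten_sum s (A - B) <=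
  2 * schatten_sum s A + 2 * schatten_sum s B.
Proof.
move=> s0 s2; set C := col_mx A B.
have [U [d Cd]] := right_svd_exists C.
have oU := proj1 Cd.
have t0 : 0 < s / 2 by rewrite divr_gt0.
have t1 : s / 2 <= 1 by lra.
apply: le_trans (lerD (schatten_sum_le_basis _ s0 s2 oU)
  (schatten_sum_le_basis _ s0 s2 oU)) _.
apply: (@le_trans _ _ (2 * schatten_sum s C)).
  rewrite (schatten_sumE _ Cd) -big_split mulr_sumr /=; apply: ler_sum => j _.
  apply: le_trans (powR_half_sum_le t0 t1 (col_sqn_ge0 _ _) (col_sqn_ge0 _ _)) _.
  rewrite mulmxDl mulmxBl col_sqn_par mulrAC divff ?mul1r// (right_svd_col j Cd).
  rewrite le_eqVlt; apply/orP; left; apply/eqP; congr (_ * _ `^ _).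
  rewrite /C mul_col_mx /col_sqn big_split_ord /=.
  by congr (_ + _); apply: eq_bigr => i _; rewrite ?col_mxEu ?col_mxEd.
rewrite -mulrDr ler_pM2l// -(schatten_sum_tr C s0) /C tr_col_mx.
by rewrite -(schatten_sum_tr A s0) -(schatten_sum_tr B s0) schatten_sum_row_mx.
Qed.

(** The Hermitian dilation, which reduces statements about rectangular matrices
    to symmetric ones and doubles sums over singular values. *)
Definition dilation m n (A : 'M[R]_(m, n)) : 'M[R]_(m + n) :=
  block_mx 0 A A^T 0.

Lemma dilation_sym m n (A : 'M[R]_(m, n)) : (dilation A)^T = dilation A.
Proof. by rewrite /dilation tr_block_mx !trmx0 trmxK. Qed.

Lemma dilationD m n (A B : 'M[R]_(m, n)) :
  dilation (A + B) = dilation A + dilation B.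
Proof. by rewrite /dilation add_block_mx !addr0 linearD. Qed.

Lemma dilationN m n (A : 'M[R]_(m, n)) : dilation (- A) = - dilation A.
Proof. by rewrite /dilation opp_block_mx !oppr0 linearN. Qed.

Lemma schatten_sum_dilation (s : R) m n (A : 'M[R]_(m, n)) : 0 < s ->
  schatten_sum s (dilation A) = 2 * schatten_sum s A.
Proof.
move=> s0; have [U [d Ad]] := right_svd_exists A.
have [V [e Ae]] := right_svd_exists A^T.
have : right_svd (dilation A) (block_mx V 0 0 U) (row_mx e d).
  split; first exact: orthogonalmx_block (proj1 Ae) (proj1 Ad).
  rewrite dilation_sym /dilation mulmx_block !mul0mx !mulmx0 !addr0 !add0r.
  rewrite (proj2 Ad); have := proj2 Ae; rewrite trmxK => ->.
  rewrite tr_block_mx !trmx0 diag_mx_row !mulmx_block !mul0mx !mulmx0.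
  by rewrite !addr0 !add0r !mul0mx.
move=> /schatten_sumE ->; rewrite big_split_ord /=.
have := schatten_sum_tr A s0; rewrite (schatten_sumE _ Ad) (schatten_sumE _ Ae).
rewrite mulrDl mul1r => {1}<-.
by congr (_ + _); apply: eq_bigr => j _; rewrite ?row_mxEl ?row_mxEr.
Qed.

Lemma frobenius_dilation m n (A B : 'M[R]_(m, n)) :
  frobenius (dilation A) (dilation B) = 2 * frobenius A B.
Proof.
rewrite /frobenius dilation_sym /dilation mulmx_block !mul0mx !mulmx0 !addr0 !add0r.
rewrite mxtrace_block mulrDl mul1r; congr (_ + _).
by rewrite mxtrace_mulC -mxtrace_tr trmx_mul trmxK.
Qed.

Lemma right_svd_sym n (U : 'M[R]_n) l : orthogonalmx U ->
  right_svd (U^T *m diag_mx l *m U) U (\row_j (l 0 j ^+ 2)).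
Proof.
move=> oU; split => //; rewrite !trmx_mul trmxK tr_diag_mx !mulmxA.
rewrite -(mulmxA _ U) oU mulmx1; congr (_ *m _); rewrite -!mulmxA; congr (_ *m _).
by rewrite mulmx_diag; congr diag_mx; apply/rowP => j; rewrite !mxE expr2.
Qed.

Lemma schatten_sum_sym (s : R) n (U : 'M[R]_n) l : orthogonalmx U ->
  schatten_sum s (U^T *m diag_mx l *m U) = \sum_j `|l 0 j| `^ s.
Proof.
move=> oU; rewrite (schatten_sumE _ (right_svd_sym l oU)).
apply: eq_bigr => j _; rewrite mxE -real_normK ?num_real// -powR_mulrn//.
by rewrite -powRrM mulrC divfK.
Qed.

Lemma mxtrace_spectral n (U V : 'M[R]_n) l k :
  \tr ((U^T *m diag_mx l *m U) *m (V^T *m diag_mx k *m V)) =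
  \sum_i \sum_j (U *m V^T) i j ^+ 2 * (l 0 i * k 0 j).
Proof.
set W := U *m V^T.
have -> : (U^T *m diag_mx l *m U) *m (V^T *m diag_mx k *m V) =
   U^T *m (diag_mx l *m (W *m diag_mx k *m V)) by rewrite /W !mulmxA.
rewrite mxtrace_mulC -!mulmxA.
have -> : U *m (V^T *m (diag_mx k *m (V *m U^T))) = W *m diag_mx k *m W^T.
  by rewrite /W trmx_mul trmxK !mulmxA.
rewrite mul_diag_mx /mxtrace; apply: eq_bigr => i _.
rewrite mxE mxE mulr_sumr; apply: eq_bigr => j _.
by rewrite mul_mx_diag [W^T j i]mxE mxE; ring.
Qed.

(** Young's inequality for traces, lifted from scalars through the doubly
    stochastic matrix of squared overlaps of two eigenbases. *)
Lemma frobenius_young (r s : R) m n (A B : 'M[R]_(m, n)) :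
  0 < r -> 0 < s -> r^-1 + s^-1 = 1 ->
  frobenius A B <= schatten_sum r A / r + schatten_sum s B / s.
Proof.
move=> r0 s0 rs; rewrite -(ler_pM2l (ltr0n R 2)) -frobenius_dilation mulrDr !mulrA.
rewrite -!schatten_sum_dilation// /frobenius dilation_sym.
have [U [l oU ->]] := real_spectral (dilation_sym A).
have [V [k oV ->]] := real_spectral (dilation_sym B).
rewrite mxtrace_spectral !schatten_sum_sym//.
have oW := orthogonalmx_mulT oU oV; set W := U *m V^T in oW *.
apply: (@le_trans _ _ (\sum_i \sum_j W i j ^+ 2 *
    (`|l 0 i| `^ r / r + `|k 0 j| `^ s / s))).
  apply: ler_sum => i _; apply: ler_sum => j _.
  rewrite ler_wpM2l ?sqr_ge0//; apply: le_trans (ler_norm _) _.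
  by rewrite normrM conjugate_powR.
under eq_bigr do under eq_bigr do rewrite mulrDr.
under eq_bigr do rewrite big_split /=.
rewrite big_split /= lerD// ?mulr_suml; last rewrite exchange_big /=.
  by apply: ler_sum => i _; rewrite -mulr_suml orthogonalmx_row ?mul1r.
by apply: ler_sum => i _; rewrite -mulr_suml orthogonalmx_col ?mul1r.
Qed.

(** The equality case of Hoelder's inequality: [A] has the singular vectors
    of [B] and its singular values raised to the power [s - 1]. *)
Lemma frobenius_attained (r s : R) m n (B : 'M[R]_(m, n)) :
  1 < s -> (s - 1) * r = s ->
  exists A, schatten_sum r A = schatten_sum s B /\
            frobenius A B = schatten_sum s B.
Proof.
move=> s1 rs; have [U [d Bd]] := right_svd_exists B.
have [oU BE] := Bd.
pose g : 'rV[R]_n := \row_j d 0 j `^ ((s - 2) / 2).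
have d0 j : 0 <= d 0 j := right_svd_ge0 j Bd.
exists (B *m U^T *m diag_mx g *m U).
have dg : d *m diag_mx g = \row_j d 0 j `^ (s / 2).
  apply/rowP => j; rewrite mul_mx_diag !mxE.
  have -> : (s - 2) / 2 = s / 2 - 1 by field.
  by rewrite mulr_powRB1//; lra.
have Ae : right_svd (B *m U^T *m diag_mx g *m U) U (\row_j (d 0 j `^ (s - 1))).
  split => //.
  rewrite !trmx_mul trmxK tr_diag_mx -!mulmxA; congr (_ *m _).
  rewrite (mulmxA B^T) BE !mulmxA -(mulmxA (diag_mx g) U) oU mulmx1.
  rewrite -(mulmxA _ U) oU mulmx1; congr (_ *m _).
  rewrite !mulmx_diag; congr diag_mx; apply/rowP => j; rewrite !mxE.
  have [->|dj] := eqVneq (d 0 j) 0.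
    by rewrite mulr0 mul0r powR0// gt_eqF// subr_gt0.
  have {}dj : 0 < d 0 j by rewrite lt0r dj d0.
  rewrite -[X in _ * X * _](powRr1 (ltW dj)) -!gt0_powRD//; congr (_ `^ _).
  by field.
split.
  rewrite (schatten_sumE _ Bd) (schatten_sumE _ Ae); apply: eq_bigr => j _.
  by rewrite mxE -powRrM; congr (_ `^ _); rewrite -[in RHS]rs mulrA.
rewrite (schatten_sumE _ Bd) /frobenius !trmx_mul trmxK tr_diag_mx.
rewrite -!mulmxA BE mxtrace_mulC !mulmxA.
rewrite -(mulmxA (diag_mx g) U) oU mulmx1 -(mulmxA _ U) oU mulmx1.
rewrite mulmx_diag mxtrace_diag; apply: eq_bigr => j _.
move/rowP: dg => /(_ j); rewrite mul_mx_diag !mxE => <-.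
by rewrite mulrC.
Qed.

End SchattenInequalities.

(** * Second-order smoothness for exponents at least two *)

Section Klein.
Variable R : realType.

(** After the rescaling [l = A x], [h = B y] this is
    [x^(s-2) y^2 <= max(x, y)^s]. *)
Lemma mixed_power_le (s l h A B : R) : 2 <= s -> 0 <= l -> 0 <= h ->
  0 < A -> 0 < B ->
  l `^ (s - 2) * h ^+ 2 <= A `^ (s - 2) * B ^+ 2 * (l `^ s / A `^ s + h `^ s / B `^ s).
Proof.
move=> s2 l0 h0 A0 B0.
have sE (x : R) : 0 <= x -> x `^ (s - 2) * x ^+ 2 = x `^ s.
  by move=> x0; rewrite -powR_mulrn// -powRD ?subrK// gt_eqF//; lra.
have [x xE] : exists x, l = A * x by exists (l / A); rewrite mulrC divfK ?gt_eqF.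
have [y yE] : exists y, h = B * y by exists (h / B); rewrite mulrC divfK ?gt_eqF.
have x0 : 0 <= x by rewrite -(pmulr_rge0 _ A0) -xE.
have y0 : 0 <= y by rewrite -(pmulr_rge0 _ B0) -yE.
have A0' := ltW A0; have B0' := ltW B0; rewrite xE yE !powRM//.
rewrite !(mulrAC (_ `^ s) (_ `^ s)) !divff ?gt_eqF ?powR_gt0// !mul1r.
have -> : A `^ (s - 2) * x `^ (s - 2) * (B * y) ^+ 2 =
  A `^ (s - 2) * B ^+ 2 * (x `^ (s - 2) * y ^+ 2) by ring.
rewrite ler_wpM2l ?mulr_ge0 ?powR_ge0 ?sqr_ge0//.
have s20 : 0 <= s - 2 by lra.
have [xy|/ltW yx] := leP x y.
  apply: (@le_trans _ _ (y `^ s)); last by rewrite lerDr powR_ge0.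
  by rewrite -sE// ler_wpM2r ?sqr_ge0// ge0_ler_powR.
apply: (@le_trans _ _ (x `^ s)); last by rewrite lerDl powR_ge0.
by rewrite -sE// ler_wpM2l ?powR_ge0// ler_sqr.
Qed.

(** A Hoelder inequality for the trace of [|X|^(s-2) H^T H], where [U]
    diagonalises [X] with eigenvalues [l]: the overlaps of the eigenbases of [X]
    and [H^T H] lift the scalar inequality.  The bounds [A] and [B] stand for
    the norms, so that no root has to be taken. *)
Lemma weighted_col_sqn_le (s : R) m n (H : 'M[R]_(m, n)) (U : 'M[R]_n)
    (l : 'rV[R]_n) A B : 2 <= s -> orthogonalmx U -> 0 < A -> 0 < B ->
  \sum_j `|l 0 j| `^ s <= A `^ s -> schatten_sum s H <= B `^ s ->
  \sum_j `|l 0 j| `^ (s - 2) * col_sqn (H *m U^T) j <= 2 * (A `^ (s - 2) * B ^+ 2).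
Proof.
move=> s2 oU A0 B0 lA HB; have [Z [d Hd]] := right_svd_exists H.
have oQ := orthogonalmx_mulT oU (proj1 Hd); set Q := U *m Z^T in oQ.
set c := A `^ _ * _.
apply: (@le_trans _ _ (\sum_i \sum_j Q i j ^+ 2 *
    (c * (`|l 0 i| `^ s / A `^ s + d 0 j `^ (s / 2) / B `^ s)))).
  apply: ler_sum => i _; rewrite (col_sqn_spectral _ _ Hd) mulr_sumr.
  apply: ler_sum => j _; rewrite -/Q mulrCA ler_wpM2l ?sqr_ge0//.
  have d0 : 0 <= d 0 j := right_svd_ge0 j Hd.
  have := mixed_power_le s2 (normr_ge0 (l 0 i)) (sqrtr_ge0 (d 0 j)) A0 B0.
  by rewrite sqr_sqrtr// -powR12_sqrt// -powRrM (mulrC 2^-1).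
under eq_bigr do under eq_bigr do rewrite mulrDr mulrDr.
under eq_bigr do rewrite big_split /=.
rewrite big_split /= [X in _ + X]exchange_big /=.
under eq_bigr do rewrite -mulr_suml orthogonalmx_row// mul1r.
under [X in _ + X]eq_bigr do rewrite -mulr_suml orthogonalmx_col// mul1r.
rewrite -!mulr_sumr -!mulr_suml -mulrDr mulrC ler_wpM2r//.
  by rewrite mulr_ge0 ?powR_ge0 ?sqr_ge0.
have := schatten_sumE s Hd => <-.
have: (\sum_j `|l 0 j| `^ s) / A `^ s <= 1 by rewrite ler_pdivrMr ?powR_gt0// mul1r.
have: schatten_sum s H / B `^ s <= 1 by rewrite ler_pdivrMr ?powR_gt0// mul1r.
lra.
Qed.

(** Up to the factor [s + 1], the derivative of [|x|^(s + 1)]. *)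
Definition signed_power (s x : R) : R := Num.sg x * `|x| `^ s.

Lemma signed_power_ge0 s x : 0 < s -> 0 <= x -> signed_power s x = x `^ s.
Proof.
move=> s0; rewrite /signed_power le_eqVlt => /predU1P[<-|x0].
  by rewrite sgr0 mul0r powR0// gt_eqF.
by rewrite gtr0_sg// gtr0_norm// mul1r.
Qed.

Lemma signed_powerN s x : signed_power s (- x) = - signed_power s x.
Proof. by rewrite /signed_power sgrN normrN mulNr. Qed.

Lemma abs_power_convex (s x y : R) : 1 < s ->
  `|y| `^ s + s * signed_power (s - 1) y * (x - y) <= `|x| `^ s.
Proof.
move=> s1; have s0 : 0 < s by lra.
have [->|y0] := eqVneq y 0.
  by rewrite /signed_power sgr0 mul0r mulr0 mul0r normr0 powR0 ?gt_eqF// addr0 powR_ge0.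
have ny : 0 < `|y| by rewrite normr_gt0.
apply: le_trans (powR_ge_tangent (ltW s1) (normr_ge0 x) ny).
rewrite lerD2l -!mulrA ler_pM2l// /signed_power mulrCA.
rewrite ler_wpM2l ?powR_ge0// mulrBr -normrEsg lerD2r.
by apply: le_trans (ler_norm _) _; rewrite normrM normr_sg y0 mul1r.
Qed.

Lemma powR_sub_le (s x y : R) : 2 <= s -> 0 <= x -> x <= y ->
  y `^ (s - 1) - x `^ (s - 1) <= (s - 1) * y `^ (s - 2) * (y - x).
Proof.
move=> s2 x0; rewrite le_eqVlt => /predU1P[<-|xy]; first by rewrite !subrr mulr0.
have y0 : 0 < y by lra.
have s1 : 1 <= s - 1 by lra.
have := powR_ge_tangent s1 x0 y0.
have -> : s - 1 - 1 = s - 2 by ring.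
set a := (s - 1) * _; have -> : a * (x - y) = - (a * (y - x)) by ring.
lra.
Qed.

Lemma signed_power_lipschitz (s x y : R) : 2 <= s ->
  (signed_power (s - 1) y - signed_power (s - 1) x) * (y - x) <=
  (s - 1) * (`|x| `^ (s - 2) + `|y| `^ (s - 2)) * (x - y) ^+ 2.
Proof.
move=> s2; have s10 : 0 < s - 1 by lra.
have E (a : R) : 0 <= a -> a `^ (s - 1) = a `^ (s - 2) * a.
  by move=> a0; rewrite -(mulr_powRB1 a0 s10) mulrC; congr (_ `^ _ * _); ring.
have same (a b : R) : 0 <= a -> a <= b ->
    (b `^ (s - 1) - a `^ (s - 1)) * (b - a) <=
    (s - 1) * (a `^ (s - 2) + b `^ (s - 2)) * (b - a) ^+ 2.
  move=> a0 ab; rewrite expr2 mulrA ler_wpM2r ?subr_ge0//.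
  apply: le_trans (powR_sub_le s2 a0 ab) _; rewrite ler_wpM2r ?subr_ge0//.
  by rewrite ler_pM2l// lerDr powR_ge0.
have same' (a b : R) : 0 <= a -> 0 <= b ->
    (b `^ (s - 1) - a `^ (s - 1)) * (b - a) <=
    (s - 1) * (a `^ (s - 2) + b `^ (s - 2)) * (b - a) ^+ 2.
  move=> a0 b0; have [ab|/ltW ba] := leP a b; first exact: same.
  have := same b a b0 ba; rewrite -(opprB a b) sqrrN mulrN -mulNr opprB.
  by rewrite (addrC (a `^ (s - 2))).
have opp (a b : R) : 0 <= a -> 0 <= b ->
    (b `^ (s - 1) + a `^ (s - 1)) * (b + a) <=
    (s - 1) * (a `^ (s - 2) + b `^ (s - 2)) * (b + a) ^+ 2.
  move=> a0 b0; rewrite expr2 mulrA ler_wpM2r ?addr_ge0// !E//.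
  have := powR_ge0 a (s - 2); have := powR_ge0 b (s - 2).
  move: (a `^ _) (b `^ _) => u v v0 u0.
  apply: (@le_trans _ _ ((u + v) * (b + a))).
    by have := mulr_ge0 u0 b0; have := mulr_ge0 v0 a0; lra.
  rewrite ler_wpM2r ?addr_ge0//.
  by rewrite ler_peMl ?addr_ge0//; lra.
have sg (a : R) : exists2 b, 0 <= b & a = b \/ a = - b.
  by have [a0|a0] := leP 0 a; [exists a; [|left]|exists (- a); [lra|right; rewrite opprK]].
have [a a0 xa] := sg x; have [b b0 yb] := sg y.
case: xa => ->; case: yb => ->; rewrite ?signed_powerN ?normrN !ger0_norm//
  !signed_power_ge0//.
- by rewrite -(sqrrN (a - b)) opprB; apply: same'.
- have := opp a b a0 b0; lra.
- have := opp a b a0 b0; lra.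
- have := same' a b a0 b0; lra.
Qed.

(** By convexity [|y|^s - |x|^s] is at most the derivative at [y] times [y - x];
    comparing the derivatives at [x] and [y] leaves a quadratic remainder. *)
Lemma klein_scalar (s x y : R) : 2 <= s ->
  `|y| `^ s - `|x| `^ s - s * signed_power (s - 1) x * (y - x) <=
  s * (s - 1) * ((`|x| `^ (s - 2) + `|y| `^ (s - 2)) * (x - y) ^+ 2).
Proof.
move=> s2; have s1 : 1 < s by lra.
have := abs_power_convex x y s1; have := signed_power_lipschitz x y s2.
have s0 : 0 <= s by lra.
move: (signed_power _ x) (signed_power _ y) => u v.
move: (`|x| `^ s) (`|y| `^ s) (`|x| `^ _) (`|y| `^ _) => c d e f.
move=> /(ler_wpM2l s0); rewrite !mulrA; lra.
Qed.

Lemma col_sqn_orthogonal m n (V : 'M[R]_m) (H : 'M[R]_(m, n)) j :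
  orthogonalmx V -> col_sqn (V *m H) j = col_sqn H j.
Proof.
move=> oV; rewrite -!col_sqnE trmx_mul -mulmxA (mulmxA V^T).
by rewrite orthogonalmxT// mul1mx.
Qed.

(** Klein's lifting: a scalar inequality between sums of products [f x * g y]
    passes to traces of functions of two symmetric matrices, because the
    squared overlaps of their eigenbases average both sides of it.  The matrix
    [Phi] is the derivative of the sum at [X]; since it is the same for all [H],
    its contributions for [H] and [- H] cancel. *)
Lemma schatten_sum_klein (s : R) n (X : 'M[R]_n) : 2 <= s -> X^T = X ->
  exists Phi : 'M[R]_n, forall (H : 'M[R]_n) (A A' B : R), H^T = H ->
    0 < A -> 0 < A' -> 0 < B -> schatten_sum s X <= A `^ s ->
    schatten_sum s (X + H) <= A' `^ s -> schatten_sum s H <= B `^ s ->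
    schatten_sum s (X + H) <= schatten_sum s X + \tr (Phi *m H) +
      2 * s * (s - 1) * (A `^ (s - 2) + A' `^ (s - 2)) * B ^+ 2.
Proof.
move=> s2 /real_spectral[U [l oU XE]].
pose f : 'rV[R]_n := \row_j (s * signed_power (s - 1) (l 0 j)).
exists (U^T *m diag_mx f *m U) => H A A' B Hsym A0 A'0 B0.
have [V [k oV YE]] : exists V, exists2 k : 'rV[R]_n, orthogonalmx V &
    X + H = V^T *m diag_mx k *m V.
  apply: real_spectral; rewrite linearD /= Hsym XE !trmx_mul trmxK tr_diag_mx.
  by rewrite mulmxA.
have HE : H = V^T *m diag_mx k *m V - U^T *m diag_mx l *m U.
  by rewrite -YE -XE addrC addKr.
rewrite YE XE !schatten_sum_sym// => XA YA HB.
have trX : \tr ((U^T *m diag_mx f *m U) *m (U^T *m diag_mx l *m U)) =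
    \sum_i f 0 i * l 0 i.
  rewrite !mulmxA -(mulmxA _ U) oU mulmx1 mxtrace_mulC !mulmxA oU mul1mx.
  by rewrite mulmx_diag mxtrace_diag; apply: eq_bigr => i _; rewrite mxE.
have oW := orthogonalmx_mulT oU oV; set W := U *m V^T in oW.
have GE i j : (U *m H *m V^T) i j = (k 0 j - l 0 i) * W i j.
  have -> : U *m H *m V^T = W *m diag_mx k - diag_mx l *m W.
    rewrite HE mulmxBr mulmxBl /W; congr (_ - _).
      by rewrite -!mulmxA oV mulmx1.
    by rewrite !mulmxA oU mul1mx.
  rewrite mxE mul_mx_diag [X in _ + X]mxE mul_diag_mx [X in X - _]mxE [X in _ - X]mxE.
  ring.
have rowE i : \sum_j W i j ^+ 2 * (l 0 i - k 0 j) ^+ 2 = col_sqn (H *m U^T) i.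
  rewrite -(col_sqn_orthogonal _ _ oV) mulmxA /col_sqn; apply: eq_bigr => j _.
  have -> : V *m H *m U^T = (U *m H *m V^T)^T by rewrite !trmx_mul trmxK Hsym mulmxA.
  by rewrite [in RHS]mxE GE; ring.
have colE j : \sum_i W i j ^+ 2 * (l 0 i - k 0 j) ^+ 2 = col_sqn (H *m V^T) j.
  rewrite -(col_sqn_orthogonal _ _ oU) mulmxA /col_sqn; apply: eq_bigr => i _.
  by rewrite GE; ring.
have KS : \sum_i \sum_j W i j ^+ 2 * (`|k 0 j| `^ s - `|l 0 i| `^ s -
      s * signed_power (s - 1) (l 0 i) * (k 0 j - l 0 i)) <=
    \sum_i \sum_j W i j ^+ 2 * (s * (s - 1) *
      ((`|l 0 i| `^ (s - 2) + `|k 0 j| `^ (s - 2)) * (l 0 i - k 0 j) ^+ 2)).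
  apply: ler_sum => i _; apply: ler_sum => j _.
  by rewrite ler_wpM2l ?sqr_ge0// klein_scalar.
have LE : \sum_i \sum_j W i j ^+ 2 * (`|k 0 j| `^ s - `|l 0 i| `^ s -
      s * signed_power (s - 1) (l 0 i) * (k 0 j - l 0 i)) =
    \sum_j `|k 0 j| `^ s - \sum_i `|l 0 i| `^ s -
    \tr ((U^T *m diag_mx f *m U) *m H).
  rewrite HE mulmxBr linearB /= trX mxtrace_spectral -/W.
  transitivity (\sum_i (\sum_j W i j ^+ 2 * `|k 0 j| `^ s - `|l 0 i| `^ s -
     (\sum_j W i j ^+ 2 * (f 0 i * k 0 j) - f 0 i * l 0 i))).
    apply: eq_bigr => i _.
    have av c : c = \sum_j W i j ^+ 2 * c.
      by rewrite -mulr_suml orthogonalmx_row ?mul1r.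
    rewrite [X in _ = _ - X - _]av [X in _ = _ - (_ - X)]av.
    by rewrite -!sumrB; apply: eq_bigr => j _; rewrite [f 0 i]mxE; ring.
  rewrite !sumrB; congr (_ - _ - (_ - _)).
  rewrite exchange_big /=; apply: eq_bigr => j _.
  by rewrite -mulr_suml (orthogonalmx_col _ oW) mul1r.
have RE : \sum_i \sum_j W i j ^+ 2 * (s * (s - 1) *
      ((`|l 0 i| `^ (s - 2) + `|k 0 j| `^ (s - 2)) * (l 0 i - k 0 j) ^+ 2)) =
   s * (s - 1) * (\sum_i `|l 0 i| `^ (s - 2) * col_sqn (H *m U^T) i +
                 \sum_j `|k 0 j| `^ (s - 2) * col_sqn (H *m V^T) j).
  under [X in _ = _ * (X + _)]eq_bigr do rewrite -rowE mulr_sumr.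
  under [X in _ = _ * (_ + X)]eq_bigr do rewrite -colE mulr_sumr.
  rewrite [X in _ = _ * (_ + X)]exchange_big -big_split /= mulr_sumr.
  apply: eq_bigr => i _; rewrite -big_split /= mulr_sumr.
  by apply: eq_bigr => j _; ring.
have s0 : 0 <= s * (s - 1) by apply: mulr_ge0; lra.
have H1 := weighted_col_sqn_le s2 oU A0 B0 XA HB.
have H2 := weighted_col_sqn_le s2 oV A'0 B0 YA HB.
have := ler_wpM2l s0 (lerD H1 H2); move: KS; rewrite LE RE => KS H3.
have := le_trans KS H3.
move: (A `^ _) (A' `^ _) (\tr _) (\sum_j _) (\sum_i _) => a a' t u v H4; lra.
Qed.

(** The first-order terms of the two Klein inequalities, for the dilations of
    [A + B] and [A - B], cancel. *)
Lemma schatten_sum_smooth (s : R) m n (A B : 'M[R]_(m, n)) a b : 2 <= s ->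
  0 < a -> 0 < b -> schatten_sum s A <= a `^ s -> schatten_sum s B <= b `^ s ->
  schatten_sum s (A + B) <= (2 * a) `^ s ->
  schatten_sum s (A - B) <= (2 * a) `^ s ->
  schatten_sum s (A + B) + schatten_sum s (A - B) <= 2 * schatten_sum s A +
    8 * s * (s - 1) * (2 `^ (s - 2) + 4 `^ (s - 2)) * (a `^ (s - 2) * b ^+ 2).
Proof.
move=> s2; have s0 : 0 < s by lra.
have s1 : 1 <= s by lra.
have two : (1 : R) <= 2 by lra.
move=> a0 b0 hA hB hp hm.
have [Phi K] := schatten_sum_klein s2 (dilation_sym A).
have dbl x c : 0 < c -> x <= c `^ s -> 2 * x <= (2 * c) `^ s.
  move=> c0 xc; apply: (@le_trans _ _ (2 * c `^ s)); first by rewrite ler_pM2l.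
  by rewrite powRM ?(ltW c0)// ler_wpM2r ?powR_ge0//; apply: le1r_powR.
have K' : forall H : 'M[R]_(m, n), schatten_sum s H <= b `^ s ->
    schatten_sum s (A + H) <= (2 * a) `^ s ->
    2 * schatten_sum s (A + H) <= 2 * schatten_sum s A +
      \tr (Phi *m dilation H) + 2 * s * (s - 1) *
      ((2 * a) `^ (s - 2) + (4 * a) `^ (s - 2)) * (2 * b) ^+ 2.
  move=> H Hb AH; rewrite -!schatten_sum_dilation// dilationD.
  apply: K; rewrite ?dilation_sym -?dilationD ?schatten_sum_dilation ?mulr_gt0 ?dbl//.
  have -> : 4 * a = 2 * (2 * a) by ring.
  by rewrite dbl ?mulr_gt0.
have := K' _ hB hp; have := K' (- B); rewrite schatten_sumN => /(_ hB hm).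
rewrite dilationN mulmxN linearN /= !powRM ?(ltW a0)//.
move: (a `^ _) (2 `^ _) (4 `^ _) (\tr _) (schatten_sum _ (A + B))
  (schatten_sum _ (A - B)) (schatten_sum _ A).
by clear=> *; lra.
Qed.

End Klein.

(** * Dual norms and power sums *)

Section Frobenius.
Variables (R : realType) (m n : nat).
Implicit Types a b x y : 'M[R]_(m, n).

Lemma frobeniusE a x : frobenius a x = \sum_i \sum_j a i j * x i j.
Proof.
rewrite /frobenius /mxtrace exchange_big /=; apply: eq_bigr => j _.
by rewrite mxE; apply: eq_bigr => i _; rewrite mxE.
Qed.

Lemma frobeniusC a x : frobenius a x = frobenius x a.
Proof.
rewrite !frobeniusE; apply: eq_bigr => i _; apply: eq_bigr => j _.
by rewrite mulrC.
Qed.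

Lemma frobeniusDl a b x : frobenius (a + b) x = frobenius a x + frobenius b x.
Proof. by rewrite /frobenius linearD /= mulmxDl linearD. Qed.

Lemma frobeniusZl c a x : frobenius (c *: a) x = c * frobenius a x.
Proof. by rewrite /frobenius linearZ /= -scalemxAl linearZ. Qed.

Lemma frobeniusNl a x : frobenius (- a) x = - frobenius a x.
Proof. by rewrite -scaleN1r frobeniusZl mulN1r. Qed.

Lemma frobeniusDr a x y : frobenius a (x + y) = frobenius a x + frobenius a y.
Proof. by rewrite frobeniusC frobeniusDl !(frobeniusC a). Qed.

Lemma frobeniusZr c a x : frobenius a (c *: x) = c * frobenius a x.
Proof. by rewrite frobeniusC frobeniusZl frobeniusC. Qed.

Lemma frobeniusNr a x : frobenius a (- x) = - frobenius a x.
Proof. by rewrite frobeniusC frobeniusNl frobeniusC. Qed.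

Lemma frobenius_delta a i j : frobenius a (delta_mx i j) = a i j.
Proof.
rewrite frobeniusE (bigD1 i)//= (bigD1 j)//= !big1 ?addr0.
- by rewrite mxE !eqxx mulr1.
- by move=> k ki; rewrite big1// => l _; rewrite mxE (negbTE ki) mulr0.
- by move=> k kj; rewrite mxE (negbTE kj) andbF mulr0.
Qed.

End Frobenius.

(** Hoelder's inequality and the attained suprema say that each of [N] and [Ns]
    is the dual norm of the other for the Frobenius inner product; homogeneity,
    definiteness and the triangle inequality are consequences. *)
Record dual_pair (R : realType) m n (N Ns : 'M[R]_(m, n) -> R) : Prop := {
  dp_ge0 : forall x, 0 <= N x;
  dp_dual_ge0 : forall a, 0 <= Ns a;
  dp_even : forall x, N (- x) = N x;
  dp_holder : forall a x, frobenius a x <= Ns a * N x;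
  dp_attained : forall a, exists2 x, N x <= 1 & frobenius a x = Ns a;
  dp_dual_attained : forall x, exists2 a, Ns a <= 1 & frobenius a x = N x }.

Section DualPair.
Variables (R : realType) (m n : nat).
Implicit Types (N Ns : 'M[R]_(m, n) -> R) (a b x y : 'M[R]_(m, n)) (c : R).

Lemma dp_dual_le N Ns a c : dual_pair N Ns ->
  (forall x, N x <= 1 -> frobenius a x <= c) -> Ns a <= c.
Proof. by move=> dp ac; have [x /ac + <-] := dp_attained dp a. Qed.

Lemma dp_frobenius_le N Ns a x : dual_pair N Ns -> N x <= 1 -> frobenius a x <= Ns a.
Proof.
move=> dp x1; apply: le_trans (dp_holder dp a x) _.
by rewrite ler_piMr// (dp_dual_ge0 dp).
Qed.

(** The symmetry exchanges the two suprema; evenness of the dual norm is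
    inherited from that of [N]. *)
Lemma dual_pair_sym N Ns : dual_pair N Ns -> dual_pair Ns N.
Proof.
move=> dp; have le a : Ns (- a) <= Ns a.
  apply: (dp_dual_le dp) => x x1; rewrite frobeniusNl -frobeniusNr.
  by apply: (dp_frobenius_le _ dp); rewrite (dp_even dp).
split; [exact: dp_dual_ge0 dp|exact: dp_ge0 dp| | | |].
- by move=> a; apply/le_anti; rewrite le -{1}(opprK a) le.
- by move=> x a; rewrite frobeniusC mulrC (dp_holder dp).
- by move=> x; have [a a1 <-] := dp_dual_attained dp x; exists a; rewrite // frobeniusC.
- by move=> a; have [x x1 <-] := dp_attained dp a; exists x; rewrite // frobeniusC.
Qed.

(** [N] is a supremum of linear functionals, by duality. *)
Lemma dp_triangle N Ns x y : dual_pair N Ns -> N (x + y) <= N x + N y.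
Proof.
move=> /dual_pair_sym dp; apply: (dp_dual_le dp) => a a1.
by rewrite frobeniusDl lerD// (dp_frobenius_le _ dp).
Qed.

Lemma dp_scale_le N Ns c x : dual_pair N Ns -> 0 <= c -> N (c *: x) <= c * N x.
Proof.
move=> /dual_pair_sym dp c0; apply: (dp_dual_le dp) => a a1.
by rewrite frobeniusZl ler_wpM2l// (dp_frobenius_le _ dp).
Qed.

Lemma dp_scale N Ns c x : dual_pair N Ns -> 0 <= c -> N (c *: x) = c * N x.
Proof.
move=> dp; rewrite le_eqVlt => /predU1P[<-|c0].
  apply/le_anti; rewrite mul0r (dp_ge0 dp) andbT.
  by apply: le_trans (dp_scale_le _ dp _) _; rewrite ?mul0r.
apply/le_anti; rewrite (dp_scale_le _ dp) ?(ltW c0)//=.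
rewrite -(ler_pdivlMl _ _ c0) -{1}[x]scale1r -(mulVf (lt0r_neq0 c0)) -scalerA.
by rewrite (dp_scale_le _ dp) ?invr_ge0 ?(ltW c0).
Qed.

Lemma dp_triangleB N Ns x y : dual_pair N Ns -> N (x - y) <= N x + N y.
Proof. by move=> dp; rewrite -(dp_even dp y); exact: dp_triangle dp. Qed.

Lemma dp_eq0 N Ns x : dual_pair N Ns -> N x = 0 -> x = 0.
Proof.
move=> dp Nx; apply/matrixP => i j; rewrite [RHS]mxE -frobenius_delta.
have H a : frobenius a x <= 0 by rewrite -[leRHS](mulr0 (Ns a)) -Nx; exact: dp_holder dp _ _.
apply/le_anti; rewrite frobeniusC H /=.
by rewrite -oppr_le0 -frobeniusNl H.
Qed.

End DualPair.

(** A function whose [s]-th root is meant to be a norm: it has the homogeneity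
    and definiteness of [N ^ s], but the triangle inequality will only follow
    from duality. *)
Record power_sum (R : realType) m n (s : R) (S : 'M[R]_(m, n) -> R) : Prop := {
  ps_ge0 : forall x, 0 <= S x;
  ps_scale : forall c x, S (c *: x) = `|c| `^ s * S x;
  ps_eq0 : forall x, S x = 0 -> x = 0 }.

Section PowerSums.
Variables (R : realType) (m n : nat).
Implicit Types (S : 'M[R]_(m, n) -> R) (a b x y : 'M[R]_(m, n)) (p r s c : R).

Lemma ps_normalize s S x : 0 < s -> power_sum s S -> x != 0 ->
  0 < S x `^ s^-1 /\ S ((S x `^ s^-1)^-1 *: x) = 1.
Proof.
move=> s0 ps x0; have Sx : 0 < S x.
  by rewrite lt0r (ps_ge0 ps) andbT; apply: contra_neq x0; exact: (ps_eq0 ps).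
have Nx : 0 < S x `^ s^-1 by rewrite powR_gt0.
split=> //; rewrite (ps_scale ps) ger0_norm ?invr_ge0 ?(ltW Nx)//.
by rewrite -powRN -powRrM mulNr mulVf ?gt_eqF// powR_inv1 ?(ltW Sx)// mulVf ?gt_eqF.
Qed.

Lemma ps_attained (r s : R) Sr Ss a : 0 < r -> 1 < s -> r^-1 + s^-1 = 1 ->
  power_sum r Sr -> power_sum s Ss ->
  (exists x, Sr x = Ss a /\ frobenius x a = Ss a) ->
  exists2 x, Sr x `^ r^-1 <= 1 & frobenius a x = Ss a `^ s^-1.
Proof.
move=> r0 s1 rs psr pss [x [xa fxa]]; have s0 : 0 < s by lra.
have [Sa|Sa] := eqVneq (Ss a) 0.
  exists x; last by rewrite frobeniusC fxa Sa powR0// invr_eq0 gt_eqF.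
  by rewrite xa Sa powR0 ?invr_eq0 ?gt_eqF.
have Sa0 : 0 < Ss a by rewrite lt0r Sa (ps_ge0 pss).
set c := Ss a `^ r^-1; have c0 : 0 < c by rewrite powR_gt0.
exists (c^-1 *: x).
  rewrite (ps_scale psr) xa ger0_norm ?invr_ge0 ?(ltW c0)//.
  rewrite /c -powRN -powRrM mulNr mulVf ?gt_eqF// powR_inv1 ?(ltW Sa0)//.
  by rewrite mulVf ?gt_eqF// powR1.
rewrite frobeniusZr frobeniusC fxa /c -powRN -[X in _ * X = _](powRr1 (ltW Sa0)).
by rewrite -gt0_powRD//; congr (_ `^ _); rewrite -rs; ring.
Qed.

(** Young's inequality for the sums, rescaled to unit vectors, is Hoelder's
    inequality for the norms; its equality cases give the attained suprema. *)
Lemma dual_pair_of_sums (r s : R) Sr Ss : 1 < r -> 1 < s -> r^-1 + s^-1 = 1 ->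
  power_sum r Sr -> power_sum s Ss ->
  (forall a x, frobenius a x <= Ss a / s + Sr x / r) ->
  (forall a, exists x, Sr x = Ss a /\ frobenius x a = Ss a) ->
  (forall x, exists a, Ss a = Sr x /\ frobenius a x = Sr x) ->
  dual_pair (fun x => Sr x `^ r^-1) (fun a => Ss a `^ s^-1).
Proof.
move=> r1 s1 rs psr pss young att att'.
have r0 : 0 < r by lra.
have s0 : 0 < s by lra.
split.
- by move=> x; exact: powR_ge0.
- by move=> x; exact: powR_ge0.
- by move=> x; rewrite -scaleN1r (ps_scale psr) normrN1 powR1 mul1r.
- move=> a x; have [->|a0] := eqVneq a 0.
    by rewrite -(scale0r a) frobeniusZl mul0r mulr_ge0 ?powR_ge0.
  have [->|x0] := eqVneq x 0.
    by rewrite -(scale0r x) frobeniusZr mul0r mulr_ge0 ?powR_ge0.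
  have [Na Sa] := ps_normalize s0 pss a0; have [Nx Sx] := ps_normalize r0 psr x0.
  have := young ((Ss a `^ s^-1)^-1 *: a) ((Sr x `^ r^-1)^-1 *: x).
  rewrite Sa Sx !mul1r addrC rs frobeniusZl frobeniusZr mulrA -invfM mulrC.
  by rewrite ler_pdivrMr ?mul1r// mulr_gt0.
- by move=> a; exact: ps_attained (att a).
- move=> x; have [|a a1 ax] := ps_attained s0 r1 _ pss psr (att' x).
    by rewrite addrC.
  by exists a; rewrite // frobeniusC.
Qed.

(** Passing from the exponent [s] of the sums to a smaller exponent [p]: for
    [Ns b <= Ns a] linearise the concave map [u |-> u `^ (p / s)] at [Ss a],
    otherwise the triangle inequality suffices. *)
Lemma smooth_of_sums p s C N Ns Ss : 0 < p -> p <= s -> 0 <= C ->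
  dual_pair N Ns -> (forall x, Ss x = Ns x `^ s) ->
  (forall a b, 0 < Ns b -> Ns b <= Ns a ->
    Ss (a + b) + Ss (a - b) <= 2 * Ss a +
      2 * C * (Ns a `^ (s - p) * Ns b `^ p)) ->
  forall a b, Ns (a + b) `^ p + Ns (a - b) `^ p <=
    2 * Ns a `^ p + 2 * (2 `^ p + C) * Ns b `^ p.
Proof.
move=> p0 ps C0 dp NsE H a b; have s0 : 0 < s by lra.
have dps := dual_pair_sym dp.
have Ns0 x : 0 <= Ns x := dp_dual_ge0 dp x.
have Ss0 x : 0 <= Ss x by rewrite NsE powR_ge0.
have [b0|b0] := eqVneq (Ns b) 0.
  have := mulr_ge0 (addr_ge0 (powR_ge0 2 p) C0) (powR_ge0 (Ns b) p).
  rewrite {2 3}(dp_eq0 dps b0) addr0 subr0.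
  by move: (2 `^ p) (Ns a `^ p) (Ns b `^ p); clear => *; lra.
have {}b0 : 0 < Ns b by rewrite lt0r b0 Ns0.
have p0' := ltW p0.
have two0 : (0 : R) <= 2 by lra.
have [ba|/ltW ab] := leP (Ns b) (Ns a); last first.
  have le x : Ns x <= Ns a + Ns b -> Ns x `^ p <= 2 `^ p * Ns b `^ p.
    move=> cab; rewrite -powRM// ge0_ler_powR ?nnegrE ?mulr_ge0//.
    by apply: le_trans cab _; lra.
  have := le _ (dp_triangle a b dps); have := le _ (dp_triangleB a b dps).
  have := powR_ge0 (Ns a) p; have := mulr_ge0 C0 (powR_ge0 (Ns b) p).
  move: (_ `^ p) (_ `^ p) (2 `^ p) (_ `^ p) (_ `^ p); clear => *; lra.
have a0 : 0 < Ns a by lra.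
have t0 : 0 < p / s by rewrite divr_gt0.
have t1 : p / s <= 1 by rewrite ler_pdivrMr// mul1r.
have as0 : 0 < Ns a `^ s by rewrite powR_gt0.
have pE x : Ns x `^ p = Ss x `^ (p / s).
  by rewrite NsE -powRrM mulrCA divff ?gt_eqF// mulr1.
have Tp := powR_le_tangent t0 t1 (Ss0 (a + b)) as0.
have Tm := powR_le_tangent t0 t1 (Ss0 (a - b)) as0.
have := H a b b0 ba; rewrite (NsE a) => Hab.
move: Tp Tm; rewrite -!pE -!powRrM.
have -> : s * (p / s) = p by rewrite mulrCA divff ?gt_eqF ?mulr1.
have -> : s * (p / s - 1) = p - s by field; rewrite gt_eqF.
set k := p / s * _; have k0 : 0 <= k by rewrite mulr_ge0 ?powR_ge0 ?(ltW t0).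
have kE : k * (2 * C * (Ns a `^ (s - p) * Ns b `^ p)) <= 2 * C * Ns b `^ p.
  have E : Ns a `^ (p - s) * Ns a `^ (s - p) = 1.
    by rewrite -gt0_powRD// (_ : p - s + (s - p) = 0) ?powRr0//; ring.
  have -> : k * (2 * C * (Ns a `^ (s - p) * Ns b `^ p)) = 
    p / s * (2 * C * Ns b `^ p) * (Ns a `^ (p - s) * Ns a `^ (s - p)).
    rewrite /k; move: (p / s) (Ns a `^ (p - s)) (Ns a `^ (s - p)) (Ns b `^ p).
    by clear=> *; ring.
  by rewrite E mulr1 ler_piMl// !mulr_ge0 ?powR_ge0.
have := ler_wpM2l k0 Hab.
have := mulr_ge0 (powR_ge0 2 p) (powR_ge0 (Ns b) p).
move: k k0 kE; move: (Ns a `^ (s - p)) (Ns a `^ s) (2 `^ p) (Ns (a + b) `^ p) (Ns (a - b) `^ p) (Ns a `^ p) (Ns b `^ p) (Ss _) (Ss _).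
clear => *; lra.
Qed.

End PowerSums.

(** * Uniform smoothness and convexity of the two families of spaces *)

Section Instances.
Variable R : realType.
Implicit Types p r s : R.

Definition uniformly_smooth p K m n (Ns : 'M[R]_(m, n) -> R) :=
  forall a b : 'M[R]_(m, n), Ns (a + b) `^ p + Ns (a - b) `^ p <=
    2 * Ns a `^ p + 2 * K * Ns b `^ p.

Lemma schatten_power_sum s m n : power_sum s (@schatten_sum R s m n).
Proof.
by split=> *; [exact: schatten_sum_ge0|rewrite schatten_sumZ|apply: schatten_sum_eq0; eassumption].
Qed.

Lemma schatten_dual_pair r s m n : 1 < r -> 1 < s -> r^-1 + s^-1 = 1 ->
  dual_pair (@schatten_norm R r m n) (@schatten_norm R s m n).
Proof.
move=> r1 s1 rs; have r0 : 0 < r by lra.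
have s0 : 0 < s by lra.
have rsE : r + s = r * s.
  have := congr1 (fun x => r * s * x) rs; rewrite mulrDr mulr1 => <-.
  by field; rewrite !gt_eqF.
apply: dual_pair_of_sums => //; try exact: schatten_power_sum.
- by move=> a x; rewrite addrC frobeniusC; exact: frobenius_young.
- by move=> a; apply: frobenius_attained => //; lra.
- by move=> x; apply: frobenius_attained => //; lra.
Qed.

Definition lr_sum s d (x : 'rV[R]_d) : R := \sum_j `|x 0 j| `^ s.

(** Vectors embed isometrically as diagonal matrices. *)
Lemma lr_sum_diag s d (x : 'rV[R]_d) : lr_sum s x = schatten_sum s (diag_mx x).
Proof.
have := @schatten_sum_sym R s d 1%:M x.
by rewrite trmx1 mulmx1 mul1mx => -> //; rewrite /orthogonalmx trmx1 mulmx1.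
Qed.

Lemma frobenius_diag d (x y : 'rV[R]_d) :
  frobenius (diag_mx x) (diag_mx y) = frobenius x y.
Proof.
rewrite [RHS]frobeniusE big_ord1 /frobenius tr_diag_mx mulmx_diag mxtrace_diag.
by apply: eq_bigr => j _; rewrite mxE.
Qed.

Lemma lr_power_sum s d : power_sum s (@lr_sum s d).
Proof.
split=> [x|c x|x]; rewrite ?lr_sum_diag; first exact: schatten_sum_ge0.
  by rewrite linearZ schatten_sumZ.
move=> /schatten_sum_eq0/matrixP x0; apply/rowP => j.
by have := x0 j j; rewrite !mxE eqxx mulr1n.
Qed.

Lemma signed_power_norm s (x : R) : 0 < s -> `|signed_power s x| = `|x| `^ s.
Proof.
move=> s0; rewrite /signed_power normrM (ger0_norm (powR_ge0 _ _)).
have [->|x0] := eqVneq x 0; last by rewrite normr_sg x0 mul1r.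
by rewrite sgr0 !normr0 mul0r powR0// gt_eqF.
Qed.

Lemma lr_attained r s d (b : 'rV[R]_d) : 1 < s -> (s - 1) * r = s ->
  exists a, lr_sum r a = lr_sum s b /\ frobenius a b = lr_sum s b.
Proof.
move=> s1 rs; have s10 : 0 < s - 1 by lra.
exists (\row_j signed_power (s - 1) (b 0 j)); split.
  apply: eq_bigr => j _; rewrite mxE signed_power_norm// -powRrM.
  by rewrite rs.
rewrite frobeniusE big_ord1; apply: eq_bigr => j _.
rewrite mxE /signed_power mulrAC -normrEsg mulr_powRB1//; lra.
Qed.

Lemma lr_dual_pair r s d : 1 < r -> 1 < s -> r^-1 + s^-1 = 1 ->
  dual_pair (@lr_norm R r d) (@lr_norm R s d).
Proof.
move=> r1 s1 rs; have r0 : 0 < r by lra.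
have s0 : 0 < s by lra.
have rsE : r + s = r * s.
  have := congr1 (fun x => r * s * x) rs; rewrite mulrDr mulr1 => <-.
  by field; rewrite !gt_eqF.
apply: (@dual_pair_of_sums R 1 d r s (@lr_sum r d) (@lr_sum s d)) => //;
  try exact: lr_power_sum.
- move=> a x; rewrite -frobenius_diag !lr_sum_diag addrC frobeniusC.
  exact: frobenius_young.
- by move=> a; apply: lr_attained => //; lra.
- by move=> x; apply: lr_attained => //; lra.
Qed.

(** The two estimates in a common form, homogeneous of degree [p] in [b]: for
    [Ns b <= Ns a] the surplus powers of [Ns b] are traded for powers of [Ns a].
    The additive map [f] is the identity for matrices and the diagonal embedding
    for vectors. *)
Lemma schatten_sum_smooth_local p s : 0 < p -> p <= 2 -> p <= s ->
  exists2 C : R, 0 <= C & forall m n (N Ns : 'M[R]_(m, n) -> R)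
    k l (f : 'M[R]_(m, n) -> 'M[R]_(k, l)),
  dual_pair N Ns -> {morph f : x y / x + y} -> {morph f : x / - x} ->
  (forall x, schatten_sum s (f x) = Ns x `^ s) ->
  forall a b, 0 < Ns b -> Ns b <= Ns a ->
    Ns (a + b) `^ s + Ns (a - b) `^ s <= 2 * Ns a `^ s +
      2 * C * (Ns a `^ (s - p) * Ns b `^ p).
Proof.
move=> p0 p2 ps; have s0 : 0 < s by lra.
have [s2|/ltW s2] := leP s 2.
  exists 1 => // m n N Ns k l f dp fD fN NsE a b b0 ba.
  have a0 : 0 < Ns a by lra.
  have sp : 0 <= s - p by lra.
  rewrite -!NsE !fD fN; apply: le_trans (schatten_sum_clarkson _ _ s0 s2) _.
  rewrite mulr1 lerD2l ler_pM2l// NsE.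
  have -> : Ns b `^ s = Ns b `^ (s - p) * Ns b `^ p by rewrite -gt0_powRD// subrK.
  rewrite ler_wpM2r ?powR_ge0//.
  by rewrite ge0_ler_powR// nnegrE ltW.
set c : R := 8 * s * (s - 1) * (2 `^ (s - 2) + 4 `^ (s - 2)).
have c0 : 0 <= c.
  have s1 : 0 <= s - 1 by lra.
  have s0' := ltW s0; have w : 0 <= (2 : R) `^ (s - 2) + 4 `^ (s - 2).
    by rewrite addr_ge0 ?powR_ge0.
  by rewrite /c !mulr_ge0.
exists (c / 2); first by rewrite divr_ge0.
move=> m n N Ns k l f dp fD fN NsE a b b0 ba.
have dps := dual_pair_sym dp.
have a0 : 0 < Ns a by lra.
have s0' := ltW s0.
have le2 x : Ns x <= Ns a + Ns b -> schatten_sum s (f x) <= (2 * Ns a) `^ s.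
  move=> xab; rewrite NsE ge0_ler_powR ?nnegrE ?(dp_dual_ge0 dp) ?mulr_ge0 ?(dp_dual_ge0 dp)//.
  by apply: le_trans xab _; lra.
have hp := le2 _ (dp_triangle a b dps); have hm := le2 _ (dp_triangleB a b dps).
rewrite fD in hp; rewrite fD fN in hm.
have := @schatten_sum_smooth R s k l (f a) (f b) (Ns a) (Ns b) s2 a0 b0.
rewrite -fN -!fD !NsE => /(_ (lexx _) (lexx _)).
rewrite -!NsE !fD fN => /(_ hp hm) /le_trans; apply; rewrite lerD2l.
have cE : 2 * (c / 2) = c by rewrite mulrC divfK.
rewrite cE -/c ler_wpM2l//.
have -> : s - p = s - 2 + (2 - p) by ring.
rewrite (gt0_powRD (s - 2) (2 - p) a0) -mulrA ler_wpM2l ?powR_ge0//.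
have -> : Ns b ^+ 2 = Ns b `^ (2 - p) * Ns b `^ p.
  by rewrite -gt0_powRD// subrK powR_mulrn// ltW.
rewrite ler_wpM2r ?powR_ge0//.
have a0' := ltW a0; have b0' := ltW b0.
by rewrite ge0_ler_powR ?nnegrE ?subr_ge0.
Qed.

(** The upper bound on [r] says that the dual exponent [s] is at least [p]; the
    constant is inherited from [schatten_sum_smooth_local], which is uniform in
    the dimension. *)
Lemma normed_space_smooth p r : 1 < p -> p <= 2 -> 1 < r -> r <= p / (p - 1) ->
  exists2 K : R, 1 <= K & forall m n (N Ns : 'M[R]_(m, n) -> R),
    normed_space r N Ns -> dual_pair N Ns /\ uniformly_smooth p K Ns.
Proof.
move=> p1 p2 r1 rp; have p0 : 0 < p by lra.
have rm0 : 0 < r - 1 by lra.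
have pm0 : 0 < p - 1 by lra.
pose s := r / (r - 1).
have sr : (r - 1) * s = r by rewrite /s mulrC divfK ?gt_eqF.
have s1 : 1 < s by rewrite /s ltr_pdivlMr// mul1r; lra.
have ps : p <= s.
  rewrite /s ler_pdivlMr//; move: rp; rewrite ler_pdivlMr//; lra.
have rs : r^-1 + s^-1 = 1.
  rewrite /s invf_div; field; lra.
have s0 : 0 < s by lra.
have [C C0 HC] := schatten_sum_smooth_local p0 p2 ps.
have K1 : 1 <= 2 `^ p + C.
  have : (1 : R) <= 2 `^ p by rewrite -{1}(powRr0 2) ler_powR//; lra.
  lra.
exists (2 `^ p + C) => // _ _ _ _ [m n|d].
  have dp := @schatten_dual_pair r s m n r1 s1 rs; split => //.
  have NsE (x : 'M[R]_(m, n)) : schatten_sum s x = schatten_norm s x `^ s.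
    by rewrite /schatten_norm -powRrM mulVf ?gt_eqF// powRr1 ?schatten_sum_ge0.
  apply: (smooth_of_sums p0 ps C0 dp NsE) => a b b0 ba; rewrite !NsE.
  exact: (HC _ _ _ _ _ _ id dp).
have dp := @lr_dual_pair r s d r1 s1 rs; split => //.
have NsE (x : 'rV[R]_d) : schatten_sum s (diag_mx x) = lr_norm s x `^ s.
  rewrite -lr_sum_diag /lr_norm -powRrM mulVf ?gt_eqF// powRr1//.
  exact: (ps_ge0 (lr_power_sum _ _)).
apply: (smooth_of_sums (Ss := fun x => schatten_sum s (diag_mx x)) p0 ps C0 dp NsE).
move=> a b b0 ba; rewrite !NsE.
apply: (HC _ _ _ _ _ _ (@diag_mx R d) dp) => //.
  by move=> x y; rewrite linearD.
by move=> x; rewrite linearN.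
Qed.

(** Young's inequality for the pairings of [x + y] and [x - y] with [a + b] and
    [a - b], where [a] and [b] are multiples of functionals norming [x] and [y],
    chosen so that the terms in [a] and [b] are absorbed. *)
Lemma convexity_of_smoothness p q K m n (N Ns : 'M[R]_(m, n) -> R) x y :
  1 < p -> 1 <= K -> dual_pair N Ns ->
  uniformly_smooth p K Ns ->
  q = p / (p - 1) ->
  2 * N x `^ q + 2 / (K `^ p^-1) `^ q * N y `^ q <=
    N (x + y) `^ q + N (x - y) `^ q.
Proof.
move=> p1 K1 dp smooth qE; have pm0 : 0 < p - 1 by lra.
have p0 : 0 < p by lra.
have K0 : 0 < K by lra.
have q1 : 1 < q by rewrite qE ltr_pdivlMr// mul1r; lra.
have q0 : 0 < q by lra.
have qp : (q - 1) * p = q by rewrite qE; field; lra.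
have pq : p^-1 + q^-1 = 1 by rewrite qE invf_div; field; lra.
set c := ((K `^ p^-1) `^ q)^-1.
have c0 : 0 < c by rewrite invr_gt0 !powR_gt0.
have cE : K * c `^ p = c.
  rewrite /c -!powRN -!powRrM -{1}(powRr1 (ltW K0)) -gt0_powRD//; congr (_ `^ _).
  by rewrite qE; field; lra.
have N0 z : 0 <= N z := dp_ge0 dp z.
have Ns0 a : 0 <= Ns a := dp_dual_ge0 dp a.
have dps := dual_pair_sym dp.
have p0' := ltW p0.
have norming z (t : R) : 0 <= t -> exists2 a, Ns a `^ p <= t `^ p * N z `^ q &
    frobenius a z = t * N z `^ q.
  move=> t0; have [a a1 az] := dp_dual_attained dp z.
  have z0 : 0 <= t * N z `^ (q - 1) by rewrite mulr_ge0 ?powR_ge0.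
  exists ((t * N z `^ (q - 1)) *: a).
    have -> : t `^ p * N z `^ q = (t * N z `^ (q - 1)) `^ p.
      by rewrite powRM ?powR_ge0// -powRrM qp.
    rewrite (dp_scale _ dps)//; apply: ge0_ler_powR; rewrite ?nnegrE//.
      by rewrite mulr_ge0.
    by rewrite ler_piMr.
  by rewrite frobeniusZl az -mulrA; congr (_ * _); rewrite mulrC mulr_powRB1.
have [a aN ax] := norming x 1 ler01; have [b bN bY] := norming y c (ltW c0).
rewrite powR1 mul1r in aN; rewrite mul1r in ax.
have young u v : frobenius u v <= Ns u `^ p / p + N v `^ q / q.
  by apply: le_trans (dp_holder dp u v) _; apply: conjugate_powR.
have pair : frobenius (a + b) (x + y) + frobenius (a - b) (x - y) =
    2 * (N x `^ q + c * N y `^ q).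
  by rewrite !frobeniusDl !frobeniusDr !frobeniusNl !frobeniusNr ax bY; ring.
have := lerD (young (a + b) (x + y)) (young (a - b) (x - y)); rewrite pair.
have := smooth a b.
have : 2 * K * Ns b `^ p <= 2 * (c * N y `^ q).
  by rewrite -{1}cE -!mulrA !ler_pM2l.
move: aN; have -> : 2 * c * N y `^ q = 2 * (c * N y `^ q) by rewrite mulrA.
move: (N (x + y) `^ q) (N (x - y) `^ q) (Ns (a + b) `^ p) (Ns (a - b) `^ p).
move: (Ns a `^ p) (N x `^ q) (2 * K * _) (c * _).
clear -pq q0 p0 => A X B Y u v a b AX BY ab H.
have {}ab : a + b <= 2 * X + 2 * Y by lra.
have := ler_wpM2r (ltW q0) H.
have -> : (a / p + u / q + (b / p + v / q)) * q = (a + b) * (p^-1 * q) + (u + v).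
  by field; lra.
have pqE : p^-1 * q = q - 1.
  by have := congr1 (fun x => x * q) pq; rewrite mulrDl mulVf ?gt_eqF// mul1r; lra.
rewrite pqE => H'.
have q1 : 0 <= q - 1 by rewrite -pqE mulr_ge0 ?invr_ge0 ?ltW.
have := ler_wpM2r q1 ab; lra.
Qed.

Lemma convexity_constant_bounds p K m n (N Ns : 'M[R]_(m, n) -> R) :
  1 < p -> 1 <= K -> dual_pair N Ns ->
  uniformly_smooth p K Ns ->
  1 <= convexity_constant (p / (p - 1)) N <= K `^ p^-1.
Proof.
move=> p1 K1 dp smooth; rewrite /convexity_constant.
set A := [set _ | _]; have AK : A (K `^ p^-1).
  split; last by move=> x y; exact: (convexity_of_smoothness _ _ p1 K1 dp smooth erefl).
  by rewrite -{1}(powRr0 K) ler_powR// invr_ge0; lra.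
apply/andP; split; first by apply: lb_le_inf; [exists (K `^ p^-1)|move=> x []].
by apply: ge_inf => //; exists 1 => x [].
Qed.

End Instances.

(** * Borel matrices and independence *)

Lemma continuous_of_lipschitz (R : realType) (V : normedModType R) (f : V -> R) C :
  (forall x y, `|f x - f y| <= C * `|x - y|) -> continuous f.
Proof.
move=> fC x; apply/cvgrPdist_lt => e e0.
have C0 : 0 < `|C| + 1 by rewrite ltr_wpDl.
near=> y; apply: le_lt_trans (fC x y) _.
apply: (@le_lt_trans _ _ ((`|C| + 1) * `|x - y|)).
  rewrite ler_wpM2r//; apply: le_trans (ler_norm C) _; lra.
rewrite -ltr_pdivlMl//; near: y.
apply/nbhs_normP; exists ((`|C| + 1)^-1 * e) => //=.
by rewrite mulr_gt0 ?invr_gt0.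
Unshelve. all: by end_near. Qed.

Section BorelMatrices.
Variables (R : realType) (m n : nat).

Lemma continuous_borel_mx (f : 'M[R]_(m, n) -> R) : continuous f ->
  measurable_fun setT (f : borel_mx R m n -> R).
Proof.
move=> /continuousP cf; apply: (measurability _ (measurable_realfun.RGenOpens.measurableE R)).
move=> _ [_ [a [b ->] <-]]; rewrite setTI.
by apply: sub_sigma_algebra; apply: cf; exact: interval_open.
Qed.

Lemma measurable_entry d (T : measurableType d) (f : T -> borel_mx R m n) i j :
  measurable_fun setT f -> measurable_fun setT (fun w => (f w : 'M[R]_(m, n)) i j).
Proof.
have mc := continuous_borel_mx (@coord_continuous R m n i j).
by move=> mf; exact: measurableT_comp mc mf.
Qed.

(** Rational boxes form a countable base of the topology of matrices, so a
    matrix-valued map is Borel as soon as its entries are. *)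
Lemma measurable_mx d (T : measurableType d) (f : T -> borel_mx R m n) :
  (forall i j, measurable_fun setT (fun w => (f w : 'M[R]_(m, n)) i j)) ->
  measurable_fun setT f.
Proof.
move=> mf; apply: (@measurability _ _ T (borel_mx R m n) setT f (@open 'M[R]_(m, n)) erefl).
move=> _ [U oU <-]; rewrite setTI.
pose box (c : 'M[rat]_(m, n) * nat) : set 'M[R]_(m, n) :=
  [set x | forall i j, `|x i j - ratr (c.1 i j)| < c.2.+1%:R^-1].
have mbox c : measurable (f @^-1` box c).
  have -> : f @^-1` box c = \bigcap_(k in [set: 'I_m * 'I_n])
      ((fun w => (f w : 'M[R]_(m, n)) k.1 k.2) @^-1`
        [set x | `|x - ratr (c.1 k.1 k.2)| < c.2.+1%:R^-1]).
    apply/seteqP; split=> w /=; first by move=> H k _; exact: H.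
    by move=> H i j; exact: (H (i, j)).
  apply: fin_bigcap_measurable => [|k _]; first exact: finite_finset.
  rewrite -[X in measurable X]setTI; apply: mf => //.
  apply: open_measurable.
  have -> : [set x : R | `|x - ratr (c.1 k.1 k.2)| < c.2.+1%:R^-1] =
      ball (ratr (c.1 k.1 k.2) : R) (c.2.+1%:R^-1 : R).
    by apply/seteqP; split=> x; rewrite /ball /= distrC.
  exact: ball_open.
have -> : f @^-1` U = \bigcup_(c in [set: 'M[rat]_(m, n) * nat])
    (f @^-1` (if `[< box c `<=` U >] then box c else set0)).
  apply/seteqP; split=> w /=; last first.
    by move=> [c _]; case: asboolP => // cU /cU.
  move=> Uw; have /nbhs_ballP[e /= e0 eU] : nbhs (f w : 'M[R]_(m, n)) U.
    by move: oU; rewrite openE => /(_ _ Uw).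
  have [k ke] : exists k : nat, k.+1%:R^-1 < e / 2.
    have e2 : 0 < e / 2 by rewrite divr_gt0.
    by have [k] := ltr_add_invr e2; rewrite add0r; exists k.
  have /choice[h hP] : forall ij : 'I_m * 'I_n, exists q : rat,
      `|(f w : 'M[R]_(m, n)) ij.1 ij.2 - ratr q| < k.+1%:R^-1.
    move=> ij; set x := (f w : 'M[R]_(m, n)) _ _.
    have [|q] := @rat_in_itvoo R (x - k.+1%:R^-1) (x + k.+1%:R^-1).
      by rewrite ltrD2l gtrN// invr_gt0.
    rewrite in_itv /= => /andP[q1 q2]; exists q.
    by rewrite distrC ltr_distl q1 q2.
  pose c := (\matrix_(i, j) h (i, j), k) : 'M[rat]_(m, n) * nat.
  exists c => //; case: asboolP => [_ i j|]; first by rewrite /c/= mxE; exact: (hP (i, j)).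
  case=> x xc; apply: eU => /=.
  split=> // i j.
  rewrite /ball/=.
  have := xc i j; rewrite /c/= mxE => H1; have := hP (i, j) => /= H2.
  have -> : (f w : 'M[R]_(m, n)) i j - x i j = ((f w : 'M[R]_(m, n)) i j - ratr (h (i, j))) - (x i j - ratr (h (i, j))) by ring.
  apply: le_lt_trans (ler_normB _ _) _; rewrite (splitr e).
  by apply: ltrD; apply: lt_trans ke.
apply: countable_bigcupT_measurable => // c.
by case: asboolP => _ //; rewrite preimage_set0.
Qed.

Section Operations.
Context d (T : measurableType d).
Implicit Types f g : T -> borel_mx R m n.

Lemma measurable_mxD f g : measurable_fun setT f -> measurable_fun setT g ->
  measurable_fun setT (fun w => (f w : 'M[R]_(m, n)) + g w : borel_mx R m n).
Proof.
move=> mf mg; apply: measurable_mx => i j.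
under eq_fun do rewrite mxE.
by apply: measurable_funD; exact: measurable_entry.
Qed.

Lemma measurable_mxZ (c : R) f : measurable_fun setT f ->
  measurable_fun setT (fun w => c *: (f w : 'M[R]_(m, n)) : borel_mx R m n).
Proof.
move=> mf; apply: measurable_mx => i j.
under eq_fun do rewrite mxE.
by apply: measurable_funM => //; exact: measurable_entry.
Qed.

Lemma measurable_mxB f g : measurable_fun setT f -> measurable_fun setT g ->
  measurable_fun setT (fun w => (f w : 'M[R]_(m, n)) - g w : borel_mx R m n).
Proof.
move=> mf mg; apply: measurable_mx => i j.
under eq_fun do rewrite !mxE.
by apply: measurable_funB; exact: measurable_entry.
Qed.

End Operations.

Lemma mx_entry_norm (x : 'M[R]_(m, n)) i j : `|x i j| <= `|x|.
Proof.
rewrite [X in _ <= X]mx_normrE.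
exact: (le_bigmax _ (fun k : 'I_m * 'I_n => `|x k.1 k.2|) (i, j)).
Qed.

End BorelMatrices.

Section IndependentIntegral.
Context d dS (T : measurableType d) (R : realType) (P : probability T R)
  (S : measurableType dS) (G : set (set T)) (X : T -> S).

(** If [X] is independent of the sigma-algebra generated by [G], the law of
    [w |-> (w, X w)] on the product of that sigma-algebra with [S] is a product
    measure; this freezes the past without disintegration. *)
Lemma independent_integral (f : g_sigma_algebraType G * S -> \bar R) :
  <<s G >> `<=` measurable -> measurable_fun setT X ->
  (forall A E, measurable A -> <<s G >> E ->
    P (X @^-1` A `&` E) = P (X @^-1` A) * P E)%E ->
  measurable_fun setT f -> (forall z, 0 <= f z)%E ->
  (\int[P]_w f (w, X w) =
   \int[P]_w \int[P]_v f (w, X v))%E.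
Proof.
move=> GM mX indep mf f0.
pose H := g_sigma_algebraType G.
have mid : measurable_fun setT (id : T -> H).
  by move=> _ B mB; rewrite setTI preimage_id; exact: GM.
pose idV : {mfun T >-> H} := HB.pack (id : T -> H) (isMeasurableFun.Build _ _ _ _ _ mid).
pose XV : {mfun T >-> S} := HB.pack X (isMeasurableFun.Build _ _ _ _ _ mX).
have mphi : measurable_fun setT (fun w => (w, X w) : H * S).
  exact: measurable_fun_pair.
pose phi : {mfun T >-> (H * S)%type} :=
  HB.pack (fun w => (w, X w) : H * S) (isMeasurableFun.Build _ _ _ _ _ mphi).
transitivity (\int[distribution P phi]_z f z)%E.
  by rewrite ge0_integral_distribution.
transitivity (\int[(distribution P idV \x distribution P XV)%E]_z f z)%E.
  apply: eq_measure_integral => A mA _; apply/esym.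
  apply: product_measure_unique => // B C mB mC /=.
  rewrite /distribution /pushforward /=.
  rewrite muleC -indep//; congr (P _); apply/seteqP; split=> w /=; tauto.
rewrite fubini_tonelli1// ge0_integral_distribution//=.
- apply: eq_integral => w _; rewrite /fubini_F ge0_integral_distribution//.
  exact: measurable_fun_pair2.
- exact: measurable_fun_fubini_tonelli_F.
- by move=> w; apply: integral_ge0.
Qed.

End IndependentIntegral.

(** * Moments of centred perturbations *)

Section DualPairTopology.
Variables (R : realType) (m n : nat) (N Ns : 'M[R]_(m, n) -> R).
Hypothesis dp : dual_pair N Ns.
Implicit Types a x z : 'M[R]_(m, n).

Lemma dp_entry_le z i j : `|z i j| <= N (delta_mx i j) * Ns z.
Proof.
rewrite ler_norml -frobenius_delta mulrC (dp_holder dp) andbT.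
by rewrite lerNl -frobeniusNl -(dp_even (dual_pair_sym dp)) (dp_holder dp).
Qed.

(** Dual norms are Lipschitz, hence Borel, for the topology of matrices, which
    is that of the maximum of the entries. *)
Lemma dp_le_mx_norm z :
  Ns z <= (\sum_(i < m) \sum_(j < n) Ns (delta_mx i j)) * `|z|.
Proof.
have [x x1 <-] := dp_attained dp z; rewrite frobeniusE mulr_suml.
apply: ler_sum => i _; rewrite mulr_suml; apply: ler_sum => j _.
apply: le_trans (ler_norm _) _; rewrite normrM mulrC.
apply: ler_pM => //; last exact: mx_entry_norm.
rewrite ler_norml -frobenius_delta.
apply/andP; split; last by rewrite frobeniusC (dp_frobenius_le _ dp).
by rewrite lerNl -frobeniusNl frobeniusC (dp_frobenius_le _ dp)// (dp_even dp).
Qed.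

Lemma dp_dist_le a z : `|Ns a - Ns z| <= Ns (a - z).
Proof.
have dps := dual_pair_sym dp.
rewrite ler_norml; apply/andP; split.
  rewrite lerNl opprB lerBlDr -(dp_even dps (a - z)) opprB.
  by rewrite -{1}(subrK a z) (dp_triangle _ _ dps).
by rewrite lerBlDr -{1}(subrK z a) (dp_triangle _ _ dps).
Qed.

Lemma dp_dual_measurable : measurable_fun setT (Ns : borel_mx R m n -> R).
Proof.
apply: continuous_borel_mx; apply: continuous_of_lipschitz => x y.
exact: le_trans (dp_dist_le x y) (dp_le_mx_norm _).
Qed.

End DualPairTopology.

Lemma lipschitz_map_measurable (R : realType) m n (N Ns : 'M[R]_(m, n) -> R)
    (f : 'M[R]_(m, n) -> 'M[R]_(m, n)) L : dual_pair N Ns -> 0 <= L ->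
  (forall x y, Ns (f x - f y) <= L * N (x - y)) ->
  measurable_fun setT (f : borel_mx R m n -> borel_mx R m n).
Proof.
move=> dp L0 fL; apply: measurable_mx => i j; apply: continuous_borel_mx.
apply: (@continuous_of_lipschitz _ _ _
  (N (delta_mx i j) * L * \sum_i \sum_j N (delta_mx i j))) => x y.
have -> : f x i j - f y i j = (f x - f y) i j by rewrite !mxE.
apply: le_trans (dp_entry_le dp _ _ _) _; rewrite -!mulrA ler_wpM2l ?(dp_ge0 dp)//.
apply: le_trans (fL x y) _; rewrite ler_wpM2l//.
exact: dp_le_mx_norm (dual_pair_sym dp) _.
Qed.

Section ConditionalStep.
Variables (R : realType) (m n : nat) (N Ns : 'M[R]_(m, n) -> R).
Hypothesis dp : dual_pair N Ns.
Variables (p K : R).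
Hypotheses (p1 : 1 < p) (K1 : 1 <= K) (smooth : uniformly_smooth p K Ns).

Let K0 : 0 <= 2 * K. Proof. by move: p1 K1 => p1' K1'; lra. Qed.

Let p0 : 0 < p. Proof. by move: p1 K1 => p1' K1'; lra. Qed.

Context d (T : measurableType d) (P : probability T R).

Let Ns0 a : 0 <= Ns a := dp_dual_ge0 dp a.

Lemma integral_prob_cst (r : R) : (\int[P]_w r%:E = r%:E)%E.
Proof.
by rewrite lebesgue_integral_nonneg.integral_cst//= probability_setT mule1.
Qed.

Lemma measurable_dual_norm_powR (Z : T -> borel_mx R m n) :
  measurable_fun setT Z -> measurable_fun setT (fun w => (Ns (Z w) `^ p)%:E).
Proof.
move=> mZ; apply/measurable_EFinP.
apply: (measurableT_comp (measurable_powR p)).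
exact: (measurableT_comp (dp_dual_measurable dp) mZ).
Qed.

(** Average [p]-smoothness over [Z], and bound the reflected term [Ns (a - Z)]
    below by Jensen's inequality along a direction norming [a]. *)
Lemma moment_centered_perturbation (Z : T -> borel_mx R m n) (c : R)
    (a : 'M[R]_(m, n)) : 0 <= c ->
  measurable_fun setT Z ->
  (forall i j, P.-integrable setT (EFin \o (fun w => (Z w : 'M[R]_(m, n)) i j))) ->
  (forall i j, \int[P]_w ((Z w : 'M[R]_(m, n)) i j)%:E = 0)%E ->
  (\int[P]_w (Ns (Z w) `^ p)%:E <= c%:E)%E ->
  (\int[P]_w (Ns (a + Z w) `^ p)%:E <= (Ns a `^ p + 2 * K * c)%:E)%E.
Proof.
move=> c0 mZ iZ meanZ momZ.
have ma : measurable_fun setT (fun _ : T => a : borel_mx R m n).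
  by apply: measurable_mx => i j; exact: measurable_cst.
have mp := measurable_dual_norm_powR (measurable_mxD ma mZ).
have mm := measurable_dual_norm_powR (measurable_mxB ma mZ).
have mz := measurable_dual_norm_powR mZ.
have up : (\int[P]_w (Ns (a + Z w) `^ p)%:E + \int[P]_w (Ns (a - Z w) `^ p)%:E <=
    (2 * Ns a `^ p + 2 * K * c)%:E)%E.
  rewrite -ge0_integralD//; try by move=> *; rewrite lee_fin powR_ge0.
  apply: (@le_trans _ _ (\int[P]_w ((2 * Ns a `^ p)%:E + (2 * K)%:E * (Ns (Z w) `^ p)%:E))%E).
    apply: ge0_le_integral => //.
    - by move=> w _; rewrite -EFinD lee_fin addr_ge0 ?powR_ge0.
    - exact: emeasurable_funD.
    - apply: emeasurable_funD; first exact: measurable_cst.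
      exact: measurable_funeM.
    - by move=> w _; rewrite -EFinM -!EFinD lee_fin; exact: smooth.
  rewrite ge0_integralD//; last 3 first.
  - by move=> w _; rewrite lee_fin mulr_ge0 ?powR_ge0.
  - by move=> w _; rewrite -EFinM lee_fin mulr_ge0 ?powR_ge0.
  - exact: measurable_funeM.
  rewrite integral_prob_cst ge0_integralZl_EFin//; last first.
  - by move=> w _; rewrite lee_fin powR_ge0.
  by rewrite EFinD leeD2l// (EFinM (2 * K)) lee_wpmul2l.
have down : ((Ns a `^ p)%:E <= \int[P]_w (Ns (a - Z w) `^ p)%:E)%E.
  have [a0|a0] := eqVneq (Ns a) 0.
    rewrite a0 powR0 ?integral_ge0//; last by rewrite gt_eqF.
    by move=> w _; rewrite lee_fin powR_ge0.
  have {}a0 : 0 < Ns a by rewrite lt0r a0 Ns0.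
  have [x x1 ax] := dp_attained dp a.
  pose k := p * Ns a `^ (p - 1).
  pose h w := Ns a `^ p - k * frobenius (Z w) x.
  have le w : h w <= Ns (a - Z w) `^ p.
    apply: le_trans (powR_ge_tangent (ltW p1) (Ns0 _) a0).
    rewrite /h -/k lerD2l -mulrN ler_wpM2l ?mulr_ge0 ?powR_ge0 ?(ltW p0)//.
    rewrite lerBrDl -{1}ax -frobeniusNl -frobeniusDl.
    exact: dp_frobenius_le dp x1.
  have frE : EFin \o (fun w => frobenius (Z w) x) =
      (fun w => \sum_i \sum_j ((x i j)%:E * ((Z w : 'M[R]_(m, n)) i j)%:E))%E.
    apply/funext => w /=; rewrite frobeniusE -sumEFin; apply: eq_bigr => i _.
    by rewrite -sumEFin; apply: eq_bigr => j _; rewrite mulrC EFinM.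
  have iz i j : P.-integrable setT
      (fun w => (x i j)%:E * ((Z w : 'M[R]_(m, n)) i j)%:E)%E.
    exact: (integrableZl _ _ (iZ i j)).
  have izs i : P.-integrable setT
      (fun w => \sum_j ((x i j)%:E * ((Z w : 'M[R]_(m, n)) i j)%:E))%E.
    exact: integrable_sum.
  have ifr : P.-integrable setT (EFin \o (fun w => frobenius (Z w) x)).
    by rewrite frE; apply: integrable_sum.
  have fr0 : (\int[P]_w (EFin \o (fun w => frobenius (Z w) x)) w = 0)%E.
    rewrite frE integral_sum//; apply: big1 => i _.
    rewrite integral_sum//; apply: big1 => j _.
    by rewrite (integralZl _ (iZ i j))// meanZ mule0.
  have ikf : P.-integrable setT (EFin \o (fun w => k * frobenius (Z w) x)).
    exact: (integrableZl _ _ ifr).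
  have ic : P.-integrable setT (EFin \o cst (Ns a `^ p)).
    exact: finite_measure_integrable_cst.
  have <- : (\int[P]_w (h w)%:E = (Ns a `^ p)%:E)%E.
    under eq_integral do rewrite EFinB.
    rewrite (integralB_EFin _ ic ikf)//.
    have -> : (\int[P]_w (k * frobenius (Z w) x)%:E = 0)%E.
      transitivity (\int[P]_w (k%:E * (EFin \o (fun w => frobenius (Z w) x)) w))%E => //.
      by rewrite integralZl// fr0 mule0.
    by rewrite sube0 /= integral_prob_cst.
  apply: le_integral => //.
  - exact: (integrableB _ ic ikf).
  - apply/integrableP; split => //.
    under eq_integral do rewrite gee0_abs ?lee_fin ?powR_ge0//.
    apply: le_lt_trans (ltry (2 * Ns a `^ p + 2 * K * c)).
    apply: le_trans up; rewrite leeDr// integral_ge0// => w _.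
    by rewrite lee_fin powR_ge0.
  - by move=> w _; rewrite lee_fin le.
have {}up : (\int[P]_w (Ns (a + Z w) `^ p)%:E + (Ns a `^ p)%:E <=
    (2 * Ns a `^ p + 2 * K * c)%:E)%E by apply: le_trans up; rewrite leeD2l.
rewrite -(@leeD2rE _ (Ns a `^ p)%:E)//; apply: le_trans up _.
by rewrite -EFinD lee_fin mulr2n mulrDl mul1r -addrA addrC.
Qed.

End ConditionalStep.

Section MomentToMean.
Context (R : realType) d (T : measurableType d) (P : probability T R).

(** Jensen's inequality for [y ^ p], through its tangent at the bound [c]. *)
Lemma mean_le_of_moment (p c : R) (Y : T -> R) : 1 < p -> 0 < c ->
  measurable_fun setT Y -> (forall w, 0 <= Y w) ->
  (\int[P]_w (Y w `^ p)%:E <= (c `^ p)%:E -> \int[P]_w (Y w)%:E <= c%:E)%E.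
Proof.
move=> p1 c0 mY Y0 momY; have p0 : 0 < p by apply: lt_trans p1.
have mY' : measurable_fun setT (EFin \o Y) by exact/measurable_EFinP.
pose k := p * c `^ (p - 1).
have k0 : 0 < k by rewrite mulr_gt0// powR_gt0.
have kc : k * c = p * c `^ p by rewrite /k -(mulr_powRB1 (ltW c0) p0); ring.
have b0 : 0 <= (p - 1) * c `^ p by rewrite mulr_ge0 ?powR_ge0// subr_ge0 ltW.
have bE : c `^ p + (p - 1) * c `^ p = k * c by rewrite kc; ring.
have mYp : measurable_fun setT (fun w => (Y w `^ p)%:E).
  by apply/measurable_EFinP; exact: (measurableT_comp (measurable_powR p)).
have : (\int[P]_w (k%:E * (Y w)%:E) <=
    \int[P]_w ((Y w `^ p)%:E + ((p - 1) * c `^ p)%:E))%E.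
  apply: ge0_le_integral => //.
  - by move=> w _; rewrite -EFinM lee_fin mulr_ge0// ltW.
  - exact: measurable_funeM.
  - by apply: emeasurable_funD => //; exact: measurable_cst.
  - move=> w _; rewrite -EFinM -EFinD lee_fin.
    have := powR_ge_tangent (ltW p1) (Y0 w) c0.
    have -> : c `^ p + p * c `^ (p - 1) * (Y w - c) = k * Y w - (p - 1) * c `^ p.
      by rewrite -/k (mulrBr k) -bE; ring.
    by rewrite lerBlDr.
rewrite ge0_integralD//; last by move=> w _; rewrite lee_fin powR_ge0.
rewrite integral_prob_cst ge0_integralZl_EFin//; last 2 first.
- by move=> w _; rewrite lee_fin.
- exact: ltW.
move=> H; rewrite -(@lee_pmul2l _ k%:E)// ?lte_fin//; apply: le_trans H _.
by rewrite -EFinM -bE EFinD leeD2r.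
Qed.

End MomentToMean.

Lemma powR_superadditive (R : realType) (p u v : R) : 1 < p -> 0 <= u -> 0 <= v ->
  u `^ p + v `^ p <= (u + v) `^ p.
Proof.
move=> p1 u0 v0; have p0 : 0 < p by apply: lt_trans p1.
have p10 : 0 <= p - 1 by rewrite subr_ge0 ltW.
rewrite -!(mulr_powRB1 _ p0) ?addr_ge0// mulrDl.
have uv := addr_ge0 u0 v0; apply: lerD; apply: ler_wpM2l => //.
  by apply: ge0_ler_powR; rewrite ?nnegrE// lerDl.
by apply: ge0_ler_powR; rewrite ?nnegrE// lerDr.
Qed.

(** * The iterates of the algorithm *)

Section Run.
Context {R : realType} {m n : nat} (N Ns : 'M[R]_(m, n) -> R).
Context (p K L sigma eta beta : R).
Hypothesis dp : dual_pair N Ns.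
Hypotheses (p1 : 1 < p) (K1 : 1 <= K) (smooth : uniformly_smooth p K Ns).
Hypotheses (L0 : 0 <= L) (sigma0 : 0 < sigma) (eta0 : 0 <= eta).
Hypotheses (beta0 : 0 <= beta) (beta1 : beta < 1).
Context (grad : 'M[R]_(m, n) -> 'M[R]_(m, n)).
Hypothesis gradL : forall x y, Ns (grad x - grad y) <= L * N (x - y).
Context {dO dS : measure_display} {Omega : measurableType dO}
  {P : probability Omega R} {S : measurableType dS}.
Context (xi : {RV P >-> S}) (g : 'M[R]_(m, n) -> S -> 'M[R]_(m, n)).
Hypothesis mg : measurable_fun setT
  (fun z : borel_mx R m n * S => g z.1 z.2 : borel_mx R m n).
Hypothesis g_mean : forall x i j,
  'E_P[fun w => g x (xi w) i j]%E = (grad x i j)%:E.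
Hypothesis g_mom : forall x,
  ('E_P[fun w => (Ns (g x (xi w) - grad x) `^ p)%R] <= (sigma `^ p)%:E)%E.
Context (xis : nat -> {RV P >-> S}) (xis_copies : independent_copies xi xis).
Context (x1 : 'M[R]_(m, n)) (x mom dir : nat -> Omega -> 'M[R]_(m, n)).
Hypothesis run : is_nssd_m P N g xis x1 (fun=> eta) (fun=> beta) x mom dir.

Local Notation alpha := (1 - beta).

Let alpha0 : 0 < alpha. Proof. by rewrite subr_gt0. Qed.

Let p0 : 0 < p. Proof. by apply: lt_trans p1. Qed.

Let mgrad : measurable_fun setT (grad : borel_mx R m n -> borel_mx R m n) :=
  lipschitz_map_measurable dp L0 gradL.

Let mxis t : measurable_fun setT (xis t).
Proof. exact: measurable_funP. Qed.

(** The sigma-algebra of the first [t] steps is kept as a type in its own right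
    ([past t] below), so that measurability with respect to the past is ordinary
    measurability of a map out of [past t]. *)
Definition history_generators (t : nat) : set (set Omega) :=
  [set E | exists2 s : nat, (0 < s <= t)%N &
        (exists2 A : set S, measurable A & E = xis s @^-1` A) \/
        (exists2 B : set (borel_mx R m n), measurable B &
           E = (dir s : Omega -> borel_mx R m n) @^-1` B)].

Local Notation past t := (g_sigma_algebraType (history_generators t)).

Lemma history_measurable t : <<s history_generators t >> `<=` measurable.
Proof.
apply: smallest_sub; first exact: sigma_algebra_measurable.
move=> E [s /andP[s0 _] [[A mA ->]|[B mB ->]]]; rewrite -[X in measurable X]setTI.
  exact: (mxis s).
exact: (nssd_measurable run s0).
Qed.

Lemma dir_past s t : (0 < s <= t)%N ->
  measurable_fun setT (dir s : past t -> borel_mx R m n).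
Proof.
move=> st _ B mB; rewrite setTI; apply: sub_sigma_algebra.
by exists s => //; right; exists B.
Qed.

Lemma sample_past s t : (0 < s <= t)%N ->
  measurable_fun setT (xis s : past t -> S).
Proof.
move=> st _ A mA; rewrite setTI; apply: sub_sigma_algebra.
by exists s => //; left; exists A.
Qed.

Lemma iterate_past s t : (s <= t)%N ->
  measurable_fun setT (x s.+1 : past t -> borel_mx R m n).
Proof.
elim: s => [_|s IH st].
  rewrite (_ : x 1%N = fun=> x1); first exact: measurable_cst.
  by apply/funext => w; rewrite (nssd_x1 run).
rewrite (_ : x s.+2 = fun w => x s.+1 w + eta *: dir s.+1 w); last first.
  by apply/funext => w; rewrite (nssd_x run).
apply: measurable_mxD; first by apply: IH; exact: ltnW.
by apply: measurable_mxZ; exact: dir_past.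
Qed.

Definition oracle_error t w := g (x t w) (xis t w) - grad (x t w).

(** The momentum recursion applied to the oracle errors; the index is shifted,
    so that [noise k] belongs to the iterate [k + 1]. *)
Fixpoint noise k w : 'M[R]_(m, n) :=
  if k is k'.+1 then beta *: noise k' w + alpha *: oracle_error k.+1 w
  else oracle_error 1 w.

Lemma oracle_error_past s t : (0 < s <= t)%N ->
  measurable_fun setT (oracle_error s : past t -> borel_mx R m n).
Proof.
case: s => // s st; have mx : measurable_fun setT (x s.+1 : past t -> borel_mx R m n).
  by apply: iterate_past; exact: ltnW.
apply: measurable_mxB; last exact: (measurableT_comp mgrad mx).
exact: (measurableT_comp mg (measurable_fun_pair mx (sample_past st))).
Qed.

Lemma noise_past k t : (k < t)%N ->
  measurable_fun setT (noise k : past t -> borel_mx R m n).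
Proof.
elim: k => [kt|k IH kt] /=; first exact: oracle_error_past.
apply: measurable_mxD; apply: measurable_mxZ; first by apply: IH; exact: ltnW.
exact: oracle_error_past.
Qed.

Lemma past_measurable d (V : measurableType d) t (f : Omega -> V) :
  measurable_fun setT (f : past t -> V) -> measurable_fun setT f.
Proof.
move=> mf _ B mB; rewrite setTI; apply: (@history_measurable t).
by have := mf measurableT B mB; rewrite setTI.
Qed.

(** A fresh sample may be replaced by the reference sample [xi]. *)
Lemma integral_sample t (f : S -> \bar R) : (0 < t)%N ->
  measurable_fun setT f -> (forall s, 0 <= f s)%E ->
  (\int[P]_w f (xis t w) = \int[P]_w f (xi w))%E.
Proof.
move=> t0 mf f0.
rewrite -(ge0_integral_distribution (xis t) mf f0).
rewrite -(ge0_integral_distribution xi mf f0).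
by apply: eq_measure_integral => A mA _; exact: (proj1 xis_copies).
Qed.

Lemma oracle_measurable y : measurable_fun setT (g y : S -> borel_mx R m n).
Proof.
have my : measurable_fun setT (fun _ : S => y : borel_mx R m n).
  by apply: measurable_mx => i j; exact: measurable_cst.
exact: (measurableT_comp mg (measurable_fun_pair my (@measurable_id _ S setT))).
Qed.

(** At a fixed point [y] the oracle error is centred, and integrable because
    its entries are dominated by [1] plus the [p]-th power of the dual norm. *)
Lemma moment_oracle_step (y a : 'M[R]_(m, n)) (c : R) : 0 <= c ->
  (\int[P]_w (Ns (a + c *: (g y (xi w) - grad y)) `^ p)%:E <=
   (Ns a `^ p + 2 * K * (c `^ p * sigma `^ p))%:E)%E.
Proof.
move=> c0; pose Z w : borel_mx R m n := g y (xi w) - grad y.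
have mgy : measurable_fun setT (fun w => g y (xi w) : borel_mx R m n).
  by apply: (measurableT_comp (oracle_measurable y)); exact: measurable_funP.
have mZ : measurable_fun setT Z.
  exact: measurable_mxB.
have momZ : (\int[P]_w (Ns (Z w) `^ p)%:E <= (sigma `^ p)%:E)%E.
  by have := g_mom y; rewrite unlock.
have mN := measurable_dual_norm_powR dp p mZ.
have imom : P.-integrable setT (fun w => (Ns (Z w) `^ p)%:E).
  apply/integrableP; split => //.
  under eq_integral do rewrite gee0_abs ?lee_fin ?powR_ge0//.
  exact: le_lt_trans momZ (ltry _).
have iZ i j : P.-integrable setT (EFin \o (fun w => (Z w : 'M[R]_(m, n)) i j)).
  have C0 : 0 <= N (delta_mx i j) by exact: (dp_ge0 dp).
  apply: (@le_integrable _ _ _ _ _ measurableT _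
     (EFin \o (fun w => N (delta_mx i j) * (1 + Ns (Z w) `^ p)))).
  - by apply/measurable_EFinP; exact: measurable_entry.
  - move=> w _; rewrite /= lee_fin.
    apply: le_trans (dp_entry_le dp _ _ _) _.
    rewrite normrM (ger0_norm C0) ler_wpM2l//; apply: le_trans (ler_norm _).
    have [h|/ltW h] := leP (Ns (Z w)) 1; first by rewrite ler_wpDr ?powR_ge0.
    by rewrite ler_wpDl// le1r_powR// ltW.
  - have i1 : P.-integrable setT (EFin \o cst (1 : R)).
      exact: finite_measure_integrable_cst.
    exact: (integrableZl measurableT (N (delta_mx i j))
      (integrableD measurableT i1 imom)).
have meanZ i j : (\int[P]_w ((Z w : 'M[R]_(m, n)) i j)%:E = 0)%E.
  have ic : P.-integrable setT (EFin \o cst (grad y i j)).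
    exact: finite_measure_integrable_cst.
  have gE : (fun w => (g y (xi w) i j)%:E) =
     (EFin \o (fun w => (Z w : 'M[R]_(m, n)) i j)) \+ (EFin \o cst (grad y i j)).
    by apply/funext => w /=; rewrite /Z !mxE -EFinD subrK.
  have := g_mean y i j; rewrite unlock gE integralD//= integral_prob_cst => H.
  by rewrite -[LHS](@addeK _ (grad y i j)%:E)// H subee.
have Zc : (\int[P]_w (Ns (c *: (Z w : 'M[R]_(m, n))) `^ p)%:E <= (c `^ p * sigma `^ p)%:E)%E.
  under eq_integral do rewrite (dp_scale _ (dual_pair_sym dp))// powRM ?(dp_dual_ge0 dp)// EFinM.
  rewrite ge0_integralZl_EFin ?powR_ge0//; last by move=> w _; rewrite lee_fin powR_ge0.
  by rewrite EFinM lee_wpmul2l ?lee_fin ?powR_ge0.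
apply: (moment_centered_perturbation dp p1 K1 smooth _ _ (measurable_mxZ c mZ)) Zc => //.
- by rewrite mulr_ge0 ?powR_ge0.
- move=> i j; rewrite (_ : _ \o _ = fun w => (c%:E * ((Z w : 'M[R]_(m, n)) i j)%:E)%E).
    exact: integrableZl (iZ i j).
  by apply/funext => w /=; rewrite mxE.
- move=> i j; under eq_integral do rewrite mxE EFinM.
  by rewrite (integralZl _ (iZ i j))// meanZ mule0.
Qed.

Let moment k := (\int[P]_w (Ns (noise k w) `^ p)%:E)%E.

Lemma moment_noise0 : (moment 0 <= (sigma `^ p)%:E)%E.
Proof.
rewrite /moment /= /oracle_error.
under eq_integral do rewrite (nssd_x1 run).
rewrite (@integral_sample 1 (fun s => (Ns (g x1 s - grad x1) `^ p)%:E))//.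
- by have := g_mom x1; rewrite unlock.
- apply: (measurable_dual_norm_powR dp); apply: measurable_mxB.
    exact: oracle_measurable.
  by apply: measurable_mx => i j; exact: measurable_cst.
- by move=> s; rewrite lee_fin powR_ge0.
Qed.

(** One step of the martingale recursion: freeze the past, then average over
    the fresh sample. *)
Lemma moment_noiseS k : (moment k.+1 <=
  (beta `^ p)%:E * moment k + (2 * K * (alpha `^ p * sigma `^ p))%:E)%E.
Proof.
pose f (z : past k.+1 * S) : \bar R :=
  (Ns (beta *: noise k z.1 + alpha *: (g (x k.+2 z.1) z.2 - grad (x k.+2 z.1))) `^ p)%:E.
have mf : measurable_fun setT f.
  apply: (measurable_dual_norm_powR dp).
  have mfst : measurable_fun setT (fst : past k.+1 * S -> past k.+1).
    exact: measurable_fst.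
  have mx : measurable_fun setT (fun z : past k.+1 * S => x k.+2 z.1 : borel_mx R m n).
    exact: (measurableT_comp (iterate_past (leqnn k.+1)) mfst).
  apply: measurable_mxD; apply: measurable_mxZ.
    exact: (measurableT_comp (noise_past (leqnn k.+1)) mfst).
  apply: measurable_mxB; last exact: (measurableT_comp mgrad mx).
  exact: (measurableT_comp mg (measurable_fun_pair mx measurable_snd)).
have f0 z : (0 <= f z)%E by rewrite lee_fin powR_ge0.
have -> : moment k.+1 = (\int[P]_w f (w, xis k.+2 w))%E by [].
have /= := @independent_integral _ _ _ _ P S (history_generators k.+1) (xis k.+2) f.
move=> -> //; last 2 first.
- exact: history_measurable.
- by move=> A E mA hE; exact: (nssd_nonanticipating run mA hE).
have mk : measurable_fun setT (fun w => (Ns (noise k w) `^ p)%:E).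
  apply: (measurable_dual_norm_powR dp); apply: (@past_measurable _ _ k.+1).
  exact: noise_past.
have mint : measurable_fun setT (fun w : Omega => \int[P]_v f (w, xis k.+2 v))%E.
  have msnd : measurable_fun setT (snd : past k.+1 * Omega -> Omega).
    exact: measurable_snd.
  have mfst : measurable_fun setT (fst : past k.+1 * Omega -> past k.+1).
    exact: measurable_fst.
  have mh : measurable_fun setT (fun z : past k.+1 * Omega => f (z.1, xis k.+2 z.2)).
    apply: (measurableT_comp mf); apply: measurable_fun_pair mfst _.
    exact: (measurableT_comp (mxis k.+2) msnd).
  have mF := @measurable_fun_fubini_tonelli_F _ _ (past k.+1) Omega R P _ mh (fun z => f0 _).
  exact: (@past_measurable _ _ k.+1 _ mF).
have msec (w : past k.+1) : measurable_fun setT (fun s => f (w, s)).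
  exact: measurable_fun_pair2 mf.
have K0 : 0 <= 2 * K * (alpha `^ p * sigma `^ p).
  by rewrite !mulr_ge0 ?powR_ge0//; apply: le_trans K1.
apply: (@le_trans _ _ (\int[P]_w ((beta `^ p)%:E * (Ns (noise k w) `^ p)%:E +
    (2 * K * (alpha `^ p * sigma `^ p))%:E))%E).
  apply: ge0_le_integral; [exact: measurableT| | exact: mint | |].
  - by move=> w _; apply: integral_ge0.
  - by apply: emeasurable_funD; [exact: measurable_funeM|exact: measurable_cst].
  move=> w _; have := integral_sample (ltn0Sn k.+1) (msec w) (fun s => f0 (w, s)).
  rewrite /f /= => ->.
  apply: le_trans (moment_oracle_step _ _ (ltW alpha0)) _.
  rewrite (dp_scale _ (dual_pair_sym dp))// powRM ?(dp_dual_ge0 dp)//.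
rewrite ge0_integralD//; last 2 first.
- by move=> w _; rewrite -EFinM lee_fin mulr_ge0 ?powR_ge0.
- exact: measurable_funeM.
rewrite integral_prob_cst ge0_integralZl_EFin ?powR_ge0//.
by move=> w _; rewrite lee_fin powR_ge0.
Qed.

(** As [beta ^ p <= beta], the increments add up to at most
    [\sum_j beta^j (1 - beta)^p <= (1 - beta)^(p - 1)]; the first error enters
    with its full weight and leaves the term [(beta^k)^p]. *)
Lemma moment_noise k : (moment k <=
  (sigma `^ p * ((beta ^+ k) `^ p + 2 * K * alpha `^ (p - 1)))%:E)%E.
Proof.
have K0 : 0 <= 2 * K by rewrite mulr_ge0//; apply: le_trans K1.
have c0 : 0 <= 2 * K * alpha `^ (p - 1) by rewrite mulr_ge0 ?powR_ge0.
elim: k => [|k IH].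
  apply: le_trans moment_noise0 _; rewrite lee_fin expr0 powR1.
  by rewrite ler_peMr ?powR_ge0// lerDl.
apply: le_trans (moment_noiseS k) _.
apply: (@le_trans _ _ ((beta `^ p)%:E *
   (sigma `^ p * ((beta ^+ k) `^ p + 2 * K * alpha `^ (p - 1)))%:E +
   (2 * K * (alpha `^ p * sigma `^ p))%:E)%E).
  by rewrite leeD2r// lee_wpmul2l// lee_fin powR_ge0.
rewrite -EFinM -EFinD lee_fin exprS powRM ?exprn_ge0//.
rewrite -(mulr_powRB1 (ltW alpha0) p0).
have bp : beta `^ p <= beta.
  have [->|b0] := eqVneq beta 0; first by rewrite powR0// gt_eqF.
  by apply: ge1r_powR (ltW p1); rewrite lt0r b0 beta0 ltW.
have := ler_wpM2r (mulr_ge0 c0 (powR_ge0 sigma p)) bp.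
move: (beta `^ p) (_ `^ (p - 1)) (sigma `^ p) ((_ ^+ k) `^ p) => u v s b H.
have -> : u * (s * (b + 2 * K * v)) + 2 * K * (alpha * v * s) =
  u * (2 * K * v * s) + (u * b * s + 2 * K * alpha * v * s) by ring.
have -> : s * (u * b + 2 * K * v) =
  beta * (2 * K * v * s) + (u * b * s + 2 * K * alpha * v * s) by ring.
by rewrite lerD2r.
Qed.

Lemma mean_noise k : (\int[P]_w (Ns (noise k w))%:E <=
  (sigma * (beta ^+ k + (2 * K) `^ p^-1 * alpha `^ ((p - 1) / p)))%:E)%E.
Proof.
have K0 : 0 < 2 * K by rewrite mulr_gt0//; apply: lt_le_trans K1.
set v := _ `^ _ * _; have v0 : 0 < v by rewrite mulr_gt0 ?powR_gt0.
have b0 : 0 <= beta ^+ k by rewrite exprn_ge0.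
have mN : measurable_fun setT (noise k : Omega -> borel_mx R m n).
  by apply: (@past_measurable _ _ k.+1); exact: noise_past.
apply: (mean_le_of_moment p1).
- by rewrite mulr_gt0// ltr_wpDl.
- exact: (measurableT_comp (dp_dual_measurable dp) mN).
- by move=> w; exact: (dp_dual_ge0 dp).
apply: le_trans (moment_noise k) _.
rewrite lee_fin powRM ?(ltW sigma0) ?addr_ge0 ?(ltW v0)//.
rewrite ler_wpM2l ?powR_ge0//; apply: le_trans (powR_superadditive p1 b0 (ltW v0)).
rewrite lerD2l /v powRM ?powR_ge0// -!powRrM mulVf ?gt_eqF// divfK ?gt_eqF//.
by rewrite powRr1// ltW.
Qed.

(** What remains of the momentum error is a geometrically weighted sum of gradient
    differences of consecutive iterates, which move by at most [eta]. *)
Lemma momentum_drift k w :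
  Ns (mom k.+1 w - grad (x k.+1 w) - noise k w) <= L * eta / alpha.
Proof.
have dps := dual_pair_sym dp.
have B0 : 0 <= L * eta / alpha by rewrite divr_ge0 ?mulr_ge0// ltW.
have Le0 : 0 <= L * eta by rewrite mulr_ge0.
elim: k => [|k IH].
  rewrite (nssd_m run)// (nssd_m0 run) /= /oracle_error (nssd_x1 run).
  have ab : beta + alpha = 1 by rewrite addrC subrK.
  rewrite -scalerDl ab scale1r subrr.
  by rewrite -(scale0r (0 : 'M[R]_(m, n))) (dp_scale _ dps)// mul0r.
rewrite (nssd_m run)//= /oracle_error.
set r := mom k.+1 w - grad (x k.+1 w) - noise k w in IH.
have -> : beta *: mom k.+1 w + alpha *: g (x k.+2 w) (xis k.+2 w) -
    grad (x k.+2 w) - (beta *: noise k w + alpha *: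
      (g (x k.+2 w) (xis k.+2 w) - grad (x k.+2 w))) =
    beta *: r + beta *: (grad (x k.+1 w) - grad (x k.+2 w)).
  by apply/matrixP => i j; rewrite /r !mxE; ring.
apply: le_trans (dp_triangle _ _ dps) _; rewrite !(dp_scale _ dps)//.
have step : Ns (grad (x k.+1 w) - grad (x k.+2 w)) <= L * eta.
  apply: le_trans (gradL _ _) _; rewrite ler_wpM2l//.
  rewrite (nssd_x run w (ltn0Sn k)) opprD addrA subrr add0r (dp_even dp) (dp_scale _ dp)//.
  by rewrite ler_piMr//; case: (nssd_argmin run w (ltn0Sn k)).
apply: (@le_trans _ _ (beta * (L * eta / alpha) + beta * (L * eta))).
  by rewrite lerD// ler_wpM2l.
have BE : alpha * (L * eta / alpha) = L * eta by rewrite mulrC divfK ?gt_eqF.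
rewrite [leRHS](_ : _ = beta * (L * eta / alpha) + L * eta).
  by rewrite lerD2l ler_piMl// ltW.
by rewrite -[X in _ = _ + X]BE -mulrDl (addrC beta) subrK mul1r.
Qed.

Context (F : 'M[R]_(m, n) -> R) (Delta1 : R).
Hypothesis descent : forall y h,
  F (y + h) <= F y + frobenius (grad y) h + L * N h ^+ 2.
Hypothesis gap : forall y, F x1 - F y <= Delta1.
Hypothesis eta_gt0 : 0 < eta.

(** The direction attains [- Ns mom], and replacing the momentum by the gradient
    costs its error once in the inner product and once in the norm. *)
Lemma one_step_descent k w : eta * Ns (grad (x k.+1 w)) <=
  F (x k.+1 w) - F (x k.+2 w) +
  2 * eta * (Ns (noise k w) + L * eta / alpha) + L * eta ^+ 2.
Proof.
have dps := dual_pair_sym dp.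
have [d1 dmin] := nssd_argmin run w (ltn0Sn k).
have N0 := dp_ge0 dp (dir k.+1 w).
set d := dir k.+1 w in d1 dmin N0; set M := mom k.+1 w in dmin.
set G := grad (x k.+1 w); set B := L * eta / alpha.
have Md : frobenius M d <= - Ns M.
  have [v v1 Mv] := dp_attained dp M.
  apply: le_trans (dmin (- v) _) _; first by rewrite (dp_even dp).
  by rewrite frobeniusNr Mv.
have e_le : Ns (M - G) <= Ns (noise k w) + B.
  rewrite -(subrK (noise k w) (M - G)) addrC.
  apply: le_trans (dp_triangle _ _ dps) _.
  by rewrite lerD2l; exact: momentum_drift.
have ed : - frobenius (M - G) d <= Ns (M - G).
  by rewrite -frobeniusNr (dp_frobenius_le _ dp)// (dp_even dp).
have GM : Ns G <= Ns M + Ns (M - G).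
  rewrite -{1}(subKr M G); exact: dp_triangleB dps.
have Gd : frobenius G d = frobenius M d - frobenius (M - G) d.
  by rewrite -frobeniusNl -frobeniusDl opprB addrC subrK.
have := descent (x k.+1 w) (eta *: d).
rewrite -(nssd_x run w (ltn0Sn k)) frobeniusZr -/G Gd (dp_scale _ dp)// exprMn => H.
have dd : L * (eta ^+ 2 * N d ^+ 2) <= L * eta ^+ 2.
  by rewrite mulrA ler_piMr ?mulr_ge0 ?sqr_ge0// expr_le1.
have H2 : eta * (frobenius M d - frobenius (M - G) d) <=
    eta * (2 * (Ns (noise k w) + B) - Ns G).
  rewrite ler_wpM2l//; lra.
lra.
Qed.

Lemma pathwise_bound T w :
  \sum_(k < T) Ns (grad (x k.+1 w)) <= Delta1 / eta +
    T%:R * (L * eta + 2 * (L * eta / alpha)) + 2 * \sum_(k < T) Ns (noise k w).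
Proof.
rewrite -(ler_pM2l eta_gt0).
have tele : eta * \sum_(k < T) Ns (grad (x k.+1 w)) <= F (x 1%N w) - F (x T.+1 w) +
    T%:R * (L * eta ^+ 2 + 2 * eta * (L * eta / alpha)) +
    2 * eta * \sum_(k < T) Ns (noise k w).
  elim: T => [|t IH]; first by rewrite !big_ord0 !mulr0 mul0r subrr !addr0.
  rewrite !big_ord_recr /= mulrDr -natr1.
  have := one_step_descent t w; move: IH.
  move: (Ns (grad _)) (Ns (noise t w)) (\sum_(_ < _) _) (\sum_(_ < _) _).
  move: (F _) (F _) (F _) (L * eta / alpha) => f1 f2 f3 B a b c d IH H.
  lra.
have := gap (x T.+1 w); rewrite (nssd_x1 run) in tele => gapT.
apply: le_trans tele _.
have -> : eta * (Delta1 / eta + T%:R * (L * eta + 2 * (L * eta / alpha)) +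
    2 * \sum_(k < T) Ns (noise k w)) = Delta1 +
    T%:R * (L * eta ^+ 2 + 2 * eta * (L * eta / alpha)) +
    2 * eta * \sum_(k < T) Ns (noise k w).
  move: (L * eta / alpha) (\sum_(_ < _) _) => B s.
  by rewrite !mulrDr mulrCA divff ?gt_eqF//; ring.
by rewrite !lerD2r.
Qed.

Context (T : nat) (tau : {RV P >-> nat}).
Hypotheses (T0 : (0 < T)%N) (tauU : uniform_independent_index xis dir T tau).

Let grad_past k t : (k <= t)%N ->
  measurable_fun setT (fun w : past t => Ns (grad (x k.+1 w))).
Proof.
move=> kt; apply: (measurableT_comp (dp_dual_measurable dp)).
exact: (measurableT_comp mgrad (iterate_past kt)).
Qed.

(** Split according to the value of [tau]; on each event [tau = k + 1] the
    integrand depends on the past of step [T], from which [tau] is independent. *)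
Lemma mean_at_random_index :
  (\int[P]_w (Ns (grad (x (tau w) w)))%:E =
   (T%:R^-1)%:E * \int[P]_w (\sum_(k < T) Ns (grad (x k.+1 w)))%:E)%E.
Proof.
have [tau_range [tau_unif tau_indep]] := tauU.
pose f k (z : past T * nat) : \bar R :=
  (\1_[set k.+1] z.2 * Ns (grad (x k.+1 z.1)))%:E.
have f0 k z : (0 <= f k z)%E.
  by rewrite lee_fin mulr_ge0// (dp_dual_ge0 dp).
have mf k : (k < T)%N -> measurable_fun setT (f k).
  move=> kT; apply/measurable_EFinP; apply: measurable_funM.
    have m1 : measurable_fun setT (\1_[set k.+1] : nat -> R) by [].
    exact: (measurableT_comp m1 measurable_snd).
  have mfst : measurable_fun setT (fst : past T * nat -> past T).
    exact: measurable_fst.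
  exact: (measurableT_comp (grad_past (ltnW kT)) mfst).
have mtau : measurable_fun setT tau by exact: measurable_funP.
have mgr k : (k < T)%N -> measurable_fun setT (fun w => Ns (grad (x k.+1 w))).
  by move=> kT; apply: (@past_measurable _ _ T); exact: grad_past (ltnW kT).
have fk k : (k < T)%N -> (\int[P]_w f k (w, tau w) =
    (T%:R^-1)%:E * \int[P]_w (Ns (grad (x k.+1 w)))%:E)%E.
  move=> kT.
  rewrite (@independent_integral _ _ _ _ P nat (history_generators T) tau (f k))//;
    first last.
  - exact: mf.
  - by move=> A E _; exact: tau_indep.
  - exact: history_measurable.
  rewrite -ge0_integralZl_EFin//; first last.
  - by apply/measurable_EFinP; exact: mgr.
  - by move=> w _; rewrite lee_fin (dp_dual_ge0 dp).
  apply: eq_integral => w _; rewrite /f /=.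
  under eq_integral do rewrite mulrC EFinM.
  rewrite ge0_integralZl_EFin ?(dp_dual_ge0 dp)//; last first.
    by apply/measurable_EFinP; apply: (measurableT_comp _ mtau).
  rewrite muleC; congr (_ * _)%E.
  have -> : (fun v => (\1_[set k.+1] (tau v))%:E) =
     (fun v => (\1_(tau @^-1` [set k.+1]) v)%:E :> \bar R) by [].
  rewrite integral_indic//; first by rewrite setIT; apply: tau_unif.
  by rewrite -[X in measurable X]setTI; exact: mtau.
transitivity (\int[P]_w (\sum_(k < T) f k (w, tau w)))%E.
  apply: eq_integral => w _; have /andP[t0 tT] := tau_range w.
  have kT : ((tau w).-1 < T)%N by rewrite prednK.
  rewrite (bigD1 (Ordinal kT))//= big1 ?adde0.
    by rewrite /f /= prednK// indicE mem_set ?mul1r.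
  move=> k; rewrite /f /= indicE => kt; rewrite memNset ?mul0r//= => tk.
  by move/eqP: kt; apply; apply/val_inj; rewrite /= tk.
have mft k : (k < T)%N -> measurable_fun setT (fun w => f k (w, tau w)).
  move=> kT; apply/measurable_EFinP; apply: measurable_funM; last exact: mgr.
  by apply: (measurableT_comp _ mtau).
rewrite ge0_integral_sum//; last by move=> k; exact: mft.
under [in RHS]eq_integral do rewrite -sumEFin.
rewrite ge0_integral_sum//; last 2 first.
- by move=> k; apply/measurable_EFinP; exact: mgr.
- by move=> k w _; rewrite lee_fin (dp_dual_ge0 dp).
rewrite ge0_sume_distrr; last first.
  by move=> k _; apply: integral_ge0 => w _; rewrite lee_fin (dp_dual_ge0 dp).
by apply: eq_bigr => k _; exact: fk.
Qed.

Lemma geometric_sum_le t : \sum_(k < t) beta ^+ k <= alpha^-1.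
Proof.
rewrite -div1r ler_pdivlMr//.
suff -> : (\sum_(k < t) beta ^+ k) * alpha = 1 - beta ^+ t.
  by rewrite lerBlDr lerDl exprn_ge0.
elim: t => [|t IH]; first by rewrite big_ord0 mul0r expr0 subrr.
by rewrite big_ord_recr /= mulrDl IH exprS; ring.
Qed.

Lemma nssd_mean_bound :
  (\int[P]_w (Ns (grad (x (tau w) w)))%:E <=
   (Delta1 / (eta * T%:R) + L * eta + 2 * (L * eta / alpha) +
    2 * (sigma / (T%:R * alpha)) +
    2 * (sigma * ((2 * K) `^ p^-1 * alpha `^ ((p - 1) / p))))%:E)%E.
Proof.
have TR : 0 < T%:R :> R by rewrite ltr0n.
set v := _ `^ _ * _ `^ _.
set A := Delta1 / eta + T%:R * (L * eta + 2 * (L * eta / alpha)).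
have mN k : measurable_fun setT (fun w => (Ns (noise k w))%:E).
  apply/measurable_EFinP; apply: (@past_measurable _ _ k.+1).
  exact: (measurableT_comp (dp_dual_measurable dp) (noise_past (ltnSn k))).
have N0 k w : (0 <= (Ns (noise k w))%:E)%E by rewrite lee_fin (dp_dual_ge0 dp).
have D0 : 0 <= Delta1 by have := gap x1; rewrite subrr.
have A0 : 0 <= A.
  by rewrite addr_ge0 ?mulr_ge0 ?addr_ge0 ?mulr_ge0 ?invr_ge0// ltW.
have bound : (\int[P]_w (\sum_(k < T) Ns (grad (x k.+1 w)))%:E <=
    (A + 2 * (sigma * (alpha^-1 + T%:R * v)))%:E)%E.
  apply: (@le_trans _ _ (\int[P]_w (A%:E + 2%:E * \sum_(k < T) (Ns (noise k w))%:E))%E).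
    apply: ge0_le_integral => //.
    - by move=> w _; rewrite lee_fin sumr_ge0// => k _; exact: (dp_dual_ge0 dp).
    - apply/measurable_EFinP; apply: measurable_sum => k.
      by apply: (@past_measurable _ _ T); apply: grad_past; exact: ltnW.
    - apply: emeasurable_funD; first exact: measurable_cst.
      by apply: measurable_funeM; apply: emeasurable_sum.
    - by move=> w _; rewrite sumEFin -EFinM -EFinD lee_fin; exact: pathwise_bound.
  rewrite ge0_integralD//; last 2 first.
  - by move=> w _; rewrite mule_ge0// sume_ge0.
  - by apply: measurable_funeM; apply: emeasurable_sum.
  rewrite integral_prob_cst (EFinD A) leeD2l// ge0_integralZl_EFin//; last 2 first.
  - by move=> w _; rewrite sume_ge0.
  - by apply: emeasurable_sum.
  rewrite (EFinM 2) lee_wpmul2l// ge0_integral_sum//.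
  apply: (@le_trans _ _ (\sum_(k < T) (sigma * (beta ^+ k + v))%:E)%E).
    by apply: lee_sum => k _; exact: mean_noise.
  rewrite sumEFin lee_fin -mulr_sumr ler_wpM2l ?(ltW sigma0)//.
  by rewrite big_split /= sumr_const card_ord -[v *+ T]mulr_natl lerD2r geometric_sum_le.
rewrite mean_at_random_index.
apply: le_trans (lee_wpmul2l _ bound) _; first by rewrite lee_fin invr_ge0 ltW.
rewrite -EFinM lee_fin /A invfM (invfM T%:R).
move: (alpha^-1) => ia; rewrite le_eqVlt; apply/orP; left; apply/eqP.
field; rewrite !gt_eqF//.
Qed.

End Run.

(** * Descent and tuning *)

Section Descent.
Variables (R : realType) (m n : nat).
Implicit Types (F : 'M[R]_(m, n) -> R) (y h : 'M[R]_(m, n)).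

Lemma diff_gradient F y h : 'd F y h = frobenius (gradient F y) h.
Proof.
rewrite frobeniusE {1}(matrix_sum_delta h) linear_sum.
apply: eq_bigr => i _; rewrite linear_sum; apply: eq_bigr => j _.
by rewrite linearZ /= mxE mulrC.
Qed.

(** The mean value theorem replaces the integral remainder, at the price of the
    constant [L] instead of [L / 2]. *)
Lemma descent_lemma F N Ns L : dual_pair N Ns -> 0 <= L ->
  (forall y, differentiable F y) ->
  (forall x y, Ns (gradient F x - gradient F y) <= L * N (x - y)) ->
  forall y h, F (y + h) <= F y + frobenius (gradient F y) h + L * N h ^+ 2.
Proof.
move=> dp L0 dF gradL y h.
pose l (t : R) : 'M[R]_(m, n) := y + t *: h.
have shift t : (fun s => s^-1 *: (F (l (s *: (1 : R) + t)) - F (l t))) =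
    (fun s => s^-1 *: (F (s *: h + l t) - F (l t))).
  apply/funext => s; congr (_ *: (F _ - _)).
  by rewrite /l /GRing.scale /= mulr1 -/(GRing.scale _ _) scalerDl addrCA addrA addrC addrA.
have dphi (t : R) : is_derive t 1 (F \o l) (frobenius (gradient F (l t)) h).
  have dv : derivable F (l t) h by exact: diff_derivable.
  split; first by rewrite /derivable /= shift.
  by rewrite /derive /= shift -/(derive F (l t) h) deriveE// diff_gradient.
have [|c] := @MVT R (F \o l) (fun t => frobenius (gradient F (l t)) h) 0 1 ltr01 (fun t _ => dphi t).
  apply: continuous_subspaceT => t; apply: differentiable_continuous.
  by apply/derivable1_diffP; case: (dphi t).
rewrite in_itv /= => /andP[c0 c1]; rewrite subr0 mulr1 /l scale1r scale0r addr0.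
move=> /eqP; rewrite subr_eq => /eqP ->; rewrite addrC -addrA lerD2l.
rewrite -lerBlDl -frobeniusNl -frobeniusDl.
apply: le_trans (dp_holder dp _ _) _; rewrite addrC expr2 mulrA.
rewrite ler_wpM2r ?(dp_ge0 dp)//; rewrite addrC.
apply: le_trans (gradL _ _) _; rewrite ler_wpM2l// addrC addKr.
by rewrite (dp_scale _ dp) ?(ltW c0)// ler_piMl ?(dp_ge0 dp)// ltW.
Qed.

End Descent.

Section ParameterTuning.
Variable R : realType.

Lemma powR_root_le (x w r : R) : 0 < r -> 0 <= x -> 0 <= w -> x <= w `^ r ->
  x `^ r^-1 <= w.
Proof.
move=> r0 x0 w0 xw; have -> : w = (w `^ r) `^ r^-1.
  by rewrite -powRrM mulfV ?gt_eqF// powRr1.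
by apply: ge0_ler_powR; rewrite ?invr_ge0 ?nnegrE ?powR_ge0// ltW.
Qed.

Lemma powR_root_ge (x w r : R) : 0 < r -> 0 <= x -> 0 <= w -> w `^ r <= x ->
  w <= x `^ r^-1.
Proof.
move=> r0 x0 w0 xw; have -> : w = (w `^ r) `^ r^-1.
  by rewrite -powRrM mulfV ?gt_eqF// powRr1.
by apply: ge0_ler_powR; rewrite ?invr_ge0 ?nnegrE ?powR_ge0// ltW.
Qed.

Lemma powR_divl (a b r : R) : 0 < a -> 0 < b -> (a / b) `^ r = a `^ r / b `^ r.
Proof.
move=> a0 b0; have ib : b^-1 = b `^ (-1) by rewrite powR_inv1// ltW.
by rewrite powRM ?invr_ge0 ?ltW// ib powRAC powR_inv1 ?powR_ge0.
Qed.

(** With [u = Delta1 L / T] and [a = 1 - beta] the stepsize makes the first and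
    third terms one and two times [sqrt (u / a)], and the second is smaller.  The two
    candidates [a1] and [a2] for [a] handle the last two terms: [a1] balances
    [sigma / (T a)] with [sigma a^(1/q)], both then being of order
    [sigma T^(-1/(q+1))], which is below [eps] once [eps] is small; [a2] balances
    [sqrt (u / a)] with [K sigma a^(1/q)], and the lower bound on [T] is exactly
    what makes this common value a small multiple of [eps]. *)
Lemma parameter_choice (p K1 : R) : 1 < p -> 1 <= K1 ->
  exists2 C : R, 0 < C & forall Delta1 L sigma : R,
    0 < Delta1 -> 0 < L -> 0 < sigma ->
  exists2 eps0 : R, 0 < eps0 & forall (eps : R) (T : nat) (K : R),
    0 < eps -> eps <= eps0 ->
    C * (Delta1 * L / eps ^+ 2) * (sigma / eps) `^ (p / (p - 1)) <= T%:R ->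
    1 <= K <= K1 `^ p^-1 ->
  let beta := momentum_parameter p Delta1 L sigma K T in
  let eta := stepsize Delta1 L beta T in
  [/\ (0 < T)%N, 0 <= beta, beta < 1, 0 < eta &
   Delta1 / (eta * T%:R) + L * eta + 2 * (L * eta / (1 - beta)) +
    2 * (sigma / (T%:R * (1 - beta))) +
    2 * (sigma * ((2 * K1) `^ p^-1 * (1 - beta) `^ ((p - 1) / p))) <= eps].
Proof.
move=> p1 K11.
have p0 : 0 < p by lra.
have K10 : 0 < K1 by lra.
have K120 : 0 < 2 * K1 by lra.
have pm : 0 < p - 1 by lra.
pose q := p / (p - 1).
have q0 : 0 < q by rewrite divr_gt0.
have q10 : 0 < q + 1 by lra.
have q20 : 0 < q + 2 by lra.
have e1 : p / (2 * p - 1) = q / (q + 1) by rewrite /q; field; lra.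
have e2 : p / (3 * p - 2) = q / (q + 2) by rewrite /q; field; lra.
have e3 : (p - 1) / p = q^-1 by rewrite /q invf_div.
pose kappa := (2 * K1) `^ p^-1.
have kappa1 : 1 <= kappa.
  rewrite /kappa -{1}(powRr0 (2 * K1)) ler_powR ?invr_ge0 ?ltW//; lra.
have kappa0 : 0 < kappa by lra.
pose Kc := K1 `^ p^-1.
have Kc0 : 0 < Kc by rewrite powR_gt0//; lra.
pose delta := (16 * kappa)^-1.
have delta0 : 0 < delta by rewrite invr_gt0 mulr_gt0.
pose C := 256 + Kc `^ q / delta `^ (q + 2).
have C1 : 0 < Kc `^ q / delta `^ (q + 2) by apply: divr_gt0; apply: powR_gt0.
have C0 : 0 < C by rewrite /C; lra.
(* The summand 256 serves the case a = 1, the other one the case a = a2. *)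
exists C => // D L s D0 L0 s0.
(* Up to this threshold the lower bound on T implies t_ge below. *)
pose eps1 := C * D * L * s `^ q / (8 * s * kappa) `^ (q + 1).
have eps10 : 0 < eps1.
  by apply: divr_gt0; rewrite ?powR_gt0 // !mulr_gt0 ?powR_gt0 ?mulr_gt0.
exists (Num.min s eps1); first by rewrite lt_min s0.
move=> e T K e0; rewrite le_min => /andP[es ee1]; rewrite -/q => HT /andP[K_ge1 K_le].
have K0 : 0 < K by lra.
have se0 : 0 < (s / e) `^ q by rewrite powR_gt0 ?divr_gt0.
have DL0 : 0 < D * L by rewrite mulr_gt0.
have T0 : 0 < T%:R :> R.
  apply: lt_le_trans HT; apply: mulr_gt0 => //; apply: mulr_gt0 => //.
  by apply: divr_gt0 => //; exact: exprn_gt0.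
have Tn0 : (0 < T)%N by rewrite -(ltr0n R).
have T1 : 1 <= T%:R :> R by rewrite ler1n.
rewrite /momentum_parameter e1 e2.
set a1 := T%:R `^ _; set a2 := (_ / _) `^ (q / (q + 2)).
set a := Num.min 1 _.
rewrite /stepsize !subKr; set eta := Num.sqrt _.
have a10 : 0 < a1 by rewrite powR_gt0.
have a0 : 0 < a by rewrite lt_min ltr01 lt_max a10.
have a_le1 : a <= 1 by rewrite ge_min lexx.
have sq0 : 0 < D * a / (L * T%:R) by rewrite divr_gt0 ?mulr_gt0.
have eta0 : 0 < eta by rewrite sqrtr_gt0.
have eta2 : eta ^+ 2 = D * a / (L * T%:R) by rewrite sqr_sqrtr// ltW.
split=> //; [by rewrite subr_ge0|by rewrite ltrBlDr ltrDl|].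
pose u := D * L / T%:R.
have u0 : 0 < u by rewrite divr_gt0.
pose v := L * eta / a.
have v0 : 0 < v by rewrite divr_gt0 ?mulr_gt0.
have v2 : v ^+ 2 = u / a.
  by rewrite /v /u expr_div_n exprMn eta2; field; rewrite !gt_eqF.
have vE : D / (eta * T%:R) = v.
  have : eta ^+ 2 * (L * T%:R) = D * a by rewrite eta2 divfK ?gt_eqF ?mulr_gt0.
  move=> H; apply: (@mulIf _ (eta * T%:R * a)); first by rewrite gt_eqF ?mulr_gt0.
  rewrite mulrA divfK ?gt_eqF ?mulr_gt0// -H /v.
  by field; rewrite !gt_eqF.
(* the lower bound on T controls u *)
pose y := e / s.
have y0 : 0 < y by rewrite divr_gt0.
have uC : C * u <= e ^+ 2 * y `^ q.
  have yE : (s / e) `^ q = (y `^ q)^-1 by rewrite /y !powR_divl// invf_div.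
  rewrite /u mulrA ler_pdivrMr//.
  move: HT; rewrite yE ler_pdivrMr ?powR_gt0// mulrA ler_pdivrMr ?exprn_gt0// !mulrA.
  by move=> /le_trans; apply; rewrite le_eqVlt; apply/orP; left; apply/eqP; ring.
(* Here e <= s enters, through y <= 1. *)
have u_le : u <= (e / 16) ^+ 2.
  have yq1 : y `^ q <= 1.
    have y1 : y <= 1 by rewrite ler_pdivrMr// mul1r.
    by rewrite -(powRr0 y) ger_powR ?y0 ?y1// ltW.
  have : 256 * u <= C * u by rewrite ler_pM2r// /C lerDl ltW.
  have : e ^+ 2 * y `^ q <= e ^+ 2 by rewrite ler_piMr// exprn_ge0// ltW.
  have -> : (e / 16) ^+ 2 = e ^+ 2 / 256 by field.
  have p256 : 0 < 256 :> R by rewrite ltr0n.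
  rewrite (ler_pdivlMr _ _ p256) (mulrC u) => H1 /le_trans; apply.
  exact: le_trans H1.
have pD2 b : 0 < b -> b `^ (q + 2) = b ^+ 2 * b `^ q.
  by move=> b0; rewrite addrC gt0_powRD// powR_mulrn// ltW.
(* The target for a2 ^ (1/q). *)
pose w := delta * e / (s * K).
have w0 : 0 < w by rewrite divr_gt0 ?mulr_gt0.
pose z := D * L / (s ^+ 2 * K ^+ 2 * T%:R).
have z0 : 0 < z by rewrite divr_gt0 ?mulr_gt0 ?exprn_gt0.
have uz : u = (s * K) ^+ 2 * z by rewrite /u /z; field; rewrite !gt_eqF.
have zw : z `^ (q + 2)^-1 <= w.
  have z0' := ltW z0; have w0' := ltW w0.
  apply: powR_root_le => //.
  have Kq : K `^ q <= C * delta `^ (q + 2).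
    have : K `^ q <= Kc `^ q.
      by apply: ge0_ler_powR => //; rewrite ?nnegrE; exact: ltW.
    move=> /le_trans; apply.
    have dq0 : 0 < delta `^ (q + 2) by exact: powR_gt0.
    by rewrite -(ler_pdivrMr _ _ dq0) /C lerDr ler0n.
  have -> : w = delta * (y / K) by rewrite /w /y; field; rewrite !gt_eqF.
  have d0' := ltW delta0; have yK0 : 0 <= y / K by exact/ltW/divr_gt0.
  rewrite powRM// powR_divl// (pD2 y)// (pD2 K)// mulrA ler_pdivlMr ?mulr_gt0 ?exprn_gt0 ?powR_gt0//.
  have Cz : C * (K ^+ 2 * z) <= y ^+ 2 * y `^ q.
    rewrite -(ler_pM2l (exprn_gt0 2 s0)).
    move: uC; rewrite uz; have {1}-> : e = s * y by rewrite /y mulrC divfK ?gt_eqF.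
    by congr (_ <= _); ring.
  have Kz0 : 0 <= K ^+ 2 * z by rewrite mulr_ge0 ?exprn_ge0// ltW.
  have dq0 : 0 <= delta `^ (q + 2) by exact: powR_ge0.
  have := ler_wpM2l dq0 Cz; have := ler_wpM2l Kz0 Kq.
  move: (K `^ q) (delta `^ _) (y ^+ 2 * _) => kq dq yy H1 H2.
  apply: le_trans H2; apply: le_trans (_ : K ^+ 2 * z * kq <= _).
    by rewrite le_eqVlt; apply/orP; left; apply/eqP; ring.
  by apply: le_trans H1 _; rewrite le_eqVlt; apply/orP; left; apply/eqP; ring.
have a2q : a2 `^ q^-1 = z `^ (q + 2)^-1.
  by rewrite /a2 -/z -powRrM; congr (_ `^ _); field; rewrite !gt_eqF.
have ua2 : u / a2 <= (e / 16) ^+ 2.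
  have zE : z = (z `^ (q + 2)^-1) ^+ 2 * a2.
    rewrite -powR_mulrn ?powR_ge0// -powRrM /a2 -/z -gt0_powRD//.
    by rewrite -{1}(powRr1 (ltW z0)); congr (_ `^ _); field; rewrite !gt_eqF.
  have a20 : 0 < a2 by rewrite powR_gt0.
  rewrite ler_pdivrMr// uz {1}zE mulrA ler_pM2r// -exprMn.
  have e16 : 0 <= e / 16 by rewrite divr_ge0// ltW.
  have sK0 : 0 <= s * K by rewrite mulr_ge0// ltW.
  rewrite ler_pXn2r ?nnegrE// ?(mulr_ge0 sK0) ?powR_ge0//.
  apply: le_trans (_ : s * K * w <= _); first by rewrite ler_pM2l ?mulr_gt0.
  have -> : s * K * w = delta * e by rewrite /w; field; rewrite !gt_eqF.
  rewrite mulrC ler_pM2l// /delta lef_pV2 ?posrE ?mulr_gt0//.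
  by rewrite ler_peMr.
have v_le : v <= e / 16.
  have e16 : 0 <= e / 16 by rewrite divr_ge0// ltW.
  rewrite -(@ler_pXn2r _ 2)// ?nnegrE ?(ltW v0)// v2.
  have a20 : 0 < a2 by rewrite powR_gt0.
  have [a2_1|a2_1] := leP 1 a2.
    have -> : a = 1 by apply/min_idPl; rewrite le_max a2_1 orbT.
    by rewrite divr1.
  apply: le_trans ua2; rewrite ler_pM2l// lef_pV2 ?posrE//.
  by rewrite le_min (ltW a2_1) le_max lexx orbT.
pose t := T%:R `^ (q + 1)^-1.
have t_ge : 8 * s * kappa / e <= t.
  have k0 : 0 < 8 * s * kappa by rewrite !mulr_gt0.
  have ke0 : 0 <= 8 * s * kappa / e by rewrite divr_ge0 ?ltW.
  have T0' := ltW T0.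
  apply: powR_root_ge => //.
  apply: le_trans HT; rewrite !powR_divl//.
  have -> : C * (D * L / e ^+ 2) * (s `^ q / e `^ q) =
      (C * D * L * s `^ q / e) / e `^ (q + 1).
    rewrite [in RHS]gt0_powRD// powRr1 ?ltW//.
    by field; rewrite !gt_eqF ?powR_gt0.
  rewrite ler_pM2r ?invr_gt0 ?powR_gt0// ler_pdivlMr// mulrC -ler_pdivlMr//.
  by rewrite powR_gt0.
have a1q : a1 `^ q^-1 = t^-1.
  rewrite /a1 -powRrM /t -powRN; congr (_ `^ _).
  by field; rewrite !gt_eqF.
have Ta1 : T%:R * a1 = t.
  rewrite -{1}(powRr1 (ltW T0)) /a1 -gt0_powRD// /t; congr (_ `^ _).
  by field; rewrite !gt_eqF.
have t0 : 0 < t by rewrite powR_gt0.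
have st : s * kappa / t <= e / 8.
  have p8 : 0 < 8 :> R by rewrite ltr0n.
  rewrite (ler_pdivrMr _ _ t0) mulrAC (ler_pdivlMr _ _ p8) (mulrC _ 8) mulrA (mulrC e).
  by rewrite -(ler_pdivrMr _ _ e0).
have a1_le : a1 <= a.
  rewrite le_min le_max lexx andbT -(powRr0 T%:R) ler_powR// oppr_le0.
  by rewrite divr_ge0// ltW.
have B : s / (T%:R * a) <= e / 8.
  apply: le_trans st; rewrite -Ta1.
  have Ta0 (b : R) : 0 < b -> 0 < T%:R * b by move=> b0; rewrite mulr_gt0.
  apply: ler_pM; first exact: ltW.
  - by rewrite invr_ge0; exact/ltW/Ta0.
  - by rewrite ler_peMr// ltW.
  - by rewrite lef_pV2 ?posrE ?Ta0// ler_pM2l.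
have G : s * (kappa * a `^ q^-1) <= e / 8.
  have : a `^ q^-1 <= t^-1 \/ a `^ q^-1 <= w.
    have q0' : 0 <= q^-1 by rewrite invr_ge0 ltW.
    have : a <= Num.max a1 a2 by rewrite ge_min lexx orbT.
    rewrite le_max => /orP[] aa; [left; rewrite -a1q|right; apply: le_trans zw; rewrite -a2q];
      by apply: ge0_ler_powR; rewrite ?nnegrE// ?powR_ge0// ltW.
  rewrite mulrA => -[H|H].
    by apply: le_trans st; rewrite ler_pM2l ?mulr_gt0.
  apply: le_trans (_ : s * kappa * w <= _); first by rewrite ler_pM2l ?mulr_gt0.
  have -> : s * kappa * w = e / 16 / K by rewrite /w /delta; field; rewrite !gt_eqF.
  have e8 : 0 <= e / 8 by rewrite divr_ge0// ltW.
  rewrite (ler_pdivrMr _ _ K0); apply: le_trans (_ : e / 8 <= _).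
    by rewrite ler_pM2l// lef_pV2 ?posrE ?ltr0n// ler_nat.
  by rewrite ler_peMr.
rewrite vE -/v e3 -/kappa.
have : L * eta <= v.
  by rewrite (ler_pdivlMr _ _ a0) ler_piMr// ltW// mulr_gt0.
move: v_le B G; move: (s / _) (s * (kappa * _)) (L * eta) => b g l.
clear -e0; clearbody v; lra.
Qed.

End ParameterTuning.

Theorem mainTheorem2 (R : realType) (p r : R) (p_gt1 : 1 < p) (p_le2 : p <= 2)
    (r_gt1 : 1 < r) (r_le : r <= p / (p - 1)) :
  exists C : R, 0 < C /\
  forall Delta1 L sigma : R, 0 < Delta1 -> 0 < L -> 0 < sigma ->
  exists eps0 : R, 0 < eps0 /\
  forall (m n : nat) (N Ns : 'M[R]_(m, n) -> R), normed_space r N Ns ->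
  forall (F : 'M[R]_(m, n) -> R) (x1 : 'M[R]_(m, n)),
    (forall x, differentiable F x) ->
    ((F x1)%:E - ereal_inf [set (F x)%:E | x in [set: 'M[R]_(m, n)]]
       <= Delta1%:E)%E ->
    (forall x y, Ns (gradient F x - gradient F y) <= L * N (x - y)) ->
  forall (dO dS : measure_display) (Omega : measurableType dO)
    (P : probability Omega R) (S : measurableType dS)
    (xi : {RV P >-> S}) (g : 'M[R]_(m, n) -> S -> 'M[R]_(m, n)),
    measurable_fun setT
      (fun z : borel_mx R m n * S => g z.1 z.2 : borel_mx R m n) ->
    (forall x i j, 'E_P[fun w => g x (xi w) i j]%E = (gradient F x i j)%:E) ->
    (forall x, 'E_P[fun w => (Ns (g x (xi w) - gradient F x) `^ p)%R]
       <= (sigma `^ p)%:E)%E ->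
  forall (xis : nat -> {RV P >-> S}), independent_copies xi xis ->
  forall (eps : R) (T : nat), 0 < eps -> eps <= eps0 ->
    C * (Delta1 * L / eps ^+ 2) * (sigma / eps) `^ (p / (p - 1)) <= T%:R ->
  let K := convexity_constant (p / (p - 1)) N in
  let beta := momentum_parameter p Delta1 L sigma K T in
  let eta := stepsize Delta1 L beta T in
  forall x mom dir : nat -> Omega -> 'M[R]_(m, n),
    is_nssd_m P N g xis x1 (fun=> eta) (fun=> beta) x mom dir ->
  forall tau : {RV P >-> nat},
    uniform_independent_index xis dir T tau ->
  ('E_P[fun w => Ns (gradient F (x (tau w) w))] <= eps%:E)%E.
Proof.
have [K1 K11 spaces] := normed_space_smooth p_gt1 p_le2 r_gt1 r_le.
have [C C0 tuning] := parameter_choice p_gt1 K11.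
exists C; split=> // Delta1 L sigma D0 L0 s0.
have [eps0 e0 {}tuning] := tuning Delta1 L sigma D0 L0 s0.
exists eps0; split=> // m n N Ns sp F x1 dF Fgap gradL dO dS Omega P S xi g mg
  g_mean g_mom xis copies eps T eps_gt0 eps_le T_ge K beta eta x mom dir run
  tau tauU.
have [dp smooth] := spaces m n N Ns sp.
have Kb := convexity_constant_bounds p_gt1 K11 dp smooth.
have [T0 beta0 beta1 eta0 le_eps] := tuning eps T K eps_gt0 eps_le T_ge Kb.
have L0' := ltW L0; have eta0' := ltW eta0.
have descent := descent_lemma dp L0' dF gradL.
have gap y : F x1 - F y <= Delta1.
  rewrite -lee_fin EFinB; apply: le_trans Fgap; apply: leeB => //.
  by apply: ereal_inf_lbound; exists y.
have := nssd_mean_bound dp p_gt1 K11 smooth L0' s0 eta0' beta0 beta1 gradL mg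
  g_mean g_mom copies run descent gap eta0 T0 tauU.
rewrite unlock => /le_trans; apply; rewrite lee_fin.
exact: le_eps.
Qed.
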